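(* Let $E$ be a real Hausdorff locally convex topological vector space, $n\in\mathbb{N}$, $k\in\mathbb{N}_0\cup\{\infty\}$. If $U\subseteq\mathbb{R}^n$ is a locally convex subset with dense interior, then the map \[\rho^k_U\colon C^k(U,E)\to\mathcal{E}^k(U,E),\quad f\mapsto(\partial^\alpha f)_{|\alpha|\le k}\] is an isomorphism of topological vector spaces with inverse \[\Phi^k_U\colon\mathcal{E}^k(U,E)\to C^k(U,E),\quad(f_\alpha)_{|\alpha|\le k}\mapsto f_0.\] In particular, the topology on $\mathcal{E}^k(U,E)$ is then generated by the family of seminorms $\|f\|'_{\mathcal{E}^l,q,K}=\max_{|\alpha|\le l}\sup_{x\in K}q(f_\alpha(x))$, where $l\in\mathbb{N}_0$ with $l\le k$, $q$ ranges over the continuous seminorms on $E$ and $K$ over the compact subsets of $U$.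
   Context: $\mathbb{N}=\{1,2,\dots\}$, $\mathbb{N}_0=\mathbb{N}\cup\{0\}$, $\|\cdot\|$ is the Euclidean norm on $\mathbb{R}^n$; $\alpha,\beta$ denote multi-indices in $(\mathbb{N}_0)^n$. Sets. A subset $U\subseteq\mathbb{R}^n$ is called locally convex if each $x\in U$ has a convex neighbourhood in $U$ (for the induced topology). It has dense interior if its interior $U^\circ$ in $\mathbb{R}^n$ is dense in $U$. $C^k$-functions. Let $U\subseteq\mathbb{R}^n$ be locally convex with dense interior. A function $f\colon U\to E$ is $C^0$ if it is continuous. For $k\ge1$, $f$ is $C^k$ if $f$ is continuous and for all $l\in\mathbb{N}$ with $l\le k$ the iterated directional derivatives $d^{(l)}f(x,y_1,\dots,y_l)=(D_{y_l}\cdots D_{y_1}f)(x)$, where $(D_yf)(x)=\lim_{t\to0}\frac{f(x+ty)-f(x)}{t}$, exist for all $x\in U^\circ$, $y_i\in\mathbb{R}^n$, the function $d^{(l)}f\colon U^\circ\times(\mathbb{R}^n)^l\to E$ is continuous and it has a (necessarily unique) continuous extension $d^{(l)}f\colon U\times(\mathbb{R}^n)^l\to E$. For $|\alpha|\le k$, $\partial^\alpha f\colon U\to E$ is the continuous extension to $U$ of the iterated partial derivative of $f|_{U^\circ}$ ($\partial^0f=f$). $C^k(U,E)$ carries the compact-open $C^k$-topology: the locally convex topology generated by the seminorms $\|f\|_{C^l,q,K}=\max_{|\alpha|\le l}\sup_{x\in K}q(\partial^\alpha f(x))$, for $l\in\mathbb{N}_0$ with $l\le k$, continuous seminorms $q$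 on $E$, compact $K\subseteq U$. Whitney jets. For an arbitrary subset $U\subseteq\mathbb{R}^n$, a $k$-jet on $U$ is a family $f=(f_\alpha)_{|\alpha|\le k}$ of functions $f_\alpha\colon U\to E$. For $l\in\mathbb{N}_0$, $l\le k$, $|\alpha|\le l$, $x,y\in U$ put $R_y^{l-|\alpha|}\partial^\alpha f(x)=f_\alpha(x)-\sum_{|\beta|\le l-|\alpha|}\frac{(x-y)^\beta}{\beta!}f_{\alpha+\beta}(y)$. $f$ is a Whitney $k$-jet if for all $l\in\mathbb{N}_0$ with $l\le k$, $|\alpha|\le l$, continuous seminorms $q$ on $E$, compact $K\subseteq U$ and $\varepsilon>0$ there is $\delta>0$ with $q(R_y^{l-|\alpha|}\partial^\alpha f(x))\le\varepsilon\|x-y\|^{l-|\alpha|}$ for all $x,y\in K$ with $0<\|x-y\|<\delta$. $\mathcal{E}^k(U,E)$ is the vector space of Whitney $k$-jets on $U$ with values in $E$, with the locally convex topology generated by the seminorms \[\|f\|_{\mathcal{E}^l,q,K}=\max_{|\alpha|\le l}\sup_{x\in K}q(f_\alpha(x))+\max_{|\alpha|\le l}\sup\Big\{\tfrac{q(R_y^{l-|\alpha|}\partial^\alpha f(x))}{\|x-y\|^{l-|\alpha|}}\colon x\ne y\text{ in }K\Big\}\] for $l\in\mathbb{N}_0$ with $l\le k$, continuous seminorms $q$ on $E$, compact $K\subseteq U$. *)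

(* Defs.v *)
From HB Require Import structures.
From mathcomp Require Import all_boot all_order all_algebra.
From mathcomp Require Import all_classical all_reals all_analysis.
Import Order.TTheory GRing.Theory Num.Theory.
Import numFieldNormedType.Exports.
Set Implicit Arguments.
Unset Strict Implicit.
Unset Printing Implicit Defensive.
Local Open Scope classical_set_scope.
Local Open Scope ring_scope.

HB.mixin Record Topological_isHausdorff T & Topological T := {
  hausdorff_subproof : hausdorff_space T
}.

#[short(type="hausdorffTvsType")]
HB.structure Definition HausdorffTvs (R : numDomainType) :=
  {E of Tvs R E & Topological_isHausdorff E}.

(* The order l <= k for l in nat and k in nat + {oo}, with None for oo. *)
Definition leq_ext (l : nat) (k : option nat) : bool :=
  if k is Some m then (l <= m)%N else true.

Section multi_indices.
Context (n : nat).

Definition mindex := {ffun 'I_n -> nat}.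

Definition msize (a : mindex) : nat := (\sum_i a i)%N.

Definition mfact (a : mindex) : nat := (\prod_i (a i)`!)%N.

(* The enumeration of the multi-indices of size at most m, each of whose
   entries is at most m. *)
Definition mindices (m : nat) : seq mindex :=
  [seq b <- [seq [ffun i => val (c i)] | c : {ffun 'I_n -> 'I_m.+1}]
     | (msize b <= m)%N].

Lemma mem_mindices m a : (a \in mindices m) = (msize a <= m)%N.
Proof.
rewrite mem_filter; case: leqP => //= am; apply/mapP.
have ai i : (a i < m.+1)%N.
  by rewrite ltnS (leq_trans _ am)// /msize (bigD1 i)//= leq_addr.
exists [ffun i => Ordinal (ai i)]; first by rewrite mem_enum.
by apply/ffunP => i; rewrite !ffunE.
Qed.

Lemma mindices_uniq m : uniq (mindices m).
Proof.
apply: filter_uniq; rewrite map_inj_uniq ?enum_uniq// => b c /ffunP bc.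
by apply/ffunP => i; apply: val_inj; have := bc i; rewrite !ffunE.
Qed.

Definition kmindex (k : option nat) := {a : mindex | leq_ext (msize a) k}.

End multi_indices.

Section euclidean.
Context {R : realType} {n : nat}.
Implicit Types x : 'rV[R]_n.

(* The norm `|x| on matrices is the sup norm. *)
Definition enorm x : R := Num.sqrt (\sum_i x 0 i ^+ 2).

Definition mpow x (a : mindex n) : R := \prod_i x 0 i ^+ a i.

Definition locally_convex_subset (U : set 'rV[R]_n) : Prop :=
  forall x, U x ->
    exists C, [/\ C `<=` U, convex_set C & within U (nbhs x) C].

Definition dense_interior (U : set 'rV[R]_n) : Prop := U `<=` closure U°.

End euclidean.

(* Topology generated by a family P of seminorms on V: the open balls of the
   seminorms in P, with arbitrary centers, form a subbase. *)
Definition seminormed {R : realType} (V : lmodType R) (P : set (V -> R)) : Type :=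
  V.

Section seminormed.
Context {R : realType} (V : lmodType R) (P : set (V -> R)).

HB.instance Definition _ := GRing.Lmodule.copy (seminormed P) V.

Definition seminorm_balls : set (set V) :=
  [set B | exists p v r, P p /\ B = [set w | p (w - v) < r]].

HB.instance Definition _ :=
  isSubBaseTopological.Build (seminormed P) seminorm_balls id.

End seminormed.

Section seminorm.
Context {R : realType} {E : tvsType R}.

Definition cont_seminorm (q : E -> R) : Prop :=
  [/\ forall x y, q (x + y) <= q x + q y,
      forall (c : R) x, q (c *: x) = `|c| * q x &
      continuous q].

End seminorm.

Section directional_derivatives.
Context {R : realType} {E : hausdorffTvsType R} {n : nat}.
Implicit Types (g : 'rV[R]_n -> E) (x y : 'rV[R]_n) (ys : seq 'rV[R]_n).

Definition is_dirD g y x (z : E) : Prop :=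
  t^-1 *: (g (x + t *: y) - g x) @[t --> (0 : R)^'] --> z.

Definition dirD y g : 'rV[R]_n -> E := fun x => xget 0 (is_dirD g y x).

Definition iter_dirD g ys : 'rV[R]_n -> E := foldl (fun h y => dirD y h) g ys.

(* All the successive directional derivatives in iter_dirD g ys exist at all
   points of O. *)
Fixpoint iter_derivable (O : set 'rV[R]_n) g ys : Prop :=
  if ys is y :: ys' then
    (forall x, O x -> exists z, is_dirD g y x z) /\
    iter_derivable O (dirD y g) ys'
  else True.

(* d^(l) g (x, y_1, .., y_l), where (y_1, .., y_l) in (R^n)^l is given by the
   rows of an l x n matrix. *)
Definition rows l (Y : 'M[R]_(l, n)) : seq 'rV[R]_n :=
  [seq row i Y | i <- enum 'I_l].

Definition dl l g (p : 'rV[R]_n * 'M[R]_(l, n)) : E :=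
  iter_dirD g (rows p.2) p.1.

(* The iterated partial derivative (d/dx_1)^(a_1) .. (d/dx_n)^(a_n) g. *)
Definition iter_partial (a : mindex n) g : 'rV[R]_n -> E :=
  foldr (fun i h => iter (a i) (dirD (delta_mx 0 i)) h) g (enum 'I_n).

End directional_derivatives.

Section linear_combinations.
Context {R : realType} {E : hausdorffTvsType R}.

Lemma cvg_lincomb (T : Type) (F : set_system T) {FF : Filter F} (c : R)
  (f g : T -> E) (a b : E) :
  f @ F --> a -> g @ F --> b ->
  (fun t => c *: f t + g t) @ F --> c *: a + b.
Proof.
move=> fa gb.
have cfa : (fun t => c *: f t) @ F --> c *: a.
  apply: (@continuous2_cvg _ _ _ _ _ _ (fun=> c : R^o) f
    (fun (d : R^o) (v : E) => d *: v) (c : R^o) a (@scale_continuous _ E (c, a))) => //.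
  exact: cvg_cst.
exact: (@continuous2_cvg _ _ _ _ _ _ _ _
  (fun u v : E => u + v) _ _ (@add_continuous E (c *: a, b))).
Qed.

Context {n : nat} (O : set 'rV[R]_n) (oO : open O).

Lemma is_dirD_lincomb (c : R) (f g h : 'rV[R]_n -> E) y x a b :
  {in O, h =1 (fun x => c *: f x + g x)} -> O x ->
  is_dirD f y x a -> is_dirD g y x b -> is_dirD h y x (c *: a + b).
Proof.
move=> hE Ox fa gb; rewrite /is_dirD.
apply: cvg_trans (@cvg_lincomb _ _ _ c _ _ _ _ fa gb); apply: near_eq_cvg.
have near_O : \forall t \near (0 : R)^', O (x + t *: y).
  apply: cvg_within.
  have xy : x + t *: y @[t --> (0 : R)] --> x.
    have : x + t *: y @[t --> (0 : R)] --> x + 0 *: y.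
      by apply: cvgD; [exact: cvg_cst|apply: cvgZr_tmp; exact: cvg_id].
    by rewrite scale0r addr0.
  by apply: xy; exact: open_nbhs_nbhs.
near=> t.
have Ot : O (x + t *: y) by near: t.
rewrite !hE ?inE// opprD addrACA -scalerBr [RHS]scalerDr.
by rewrite !scalerA mulrC.
Unshelve. all: by end_near. Qed.

Lemma dirDE (f : 'rV[R]_n -> E) y x a : is_dirD f y x a -> dirD y f x = a.
Proof.
move=> fa; rewrite /dirD; case: xgetP => [z _ fz|/(_ a)//].
exact: (@cvg_unique E hausdorff_subproof
  (t^-1 *: (f (x + t *: y) - f x) @[t --> (0 : R)^']) _ z a fz fa).
Qed.

Lemma iter_dirD_lincomb (c : R) (f g h : 'rV[R]_n -> E) ys :
  {in O, h =1 (fun x => c *: f x + g x)} ->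
  iter_derivable O f ys -> iter_derivable O g ys ->
  iter_derivable O h ys /\
  {in O, iter_dirD h ys =1 (fun x => c *: iter_dirD f ys x + iter_dirD g ys x)}.
Proof.
elim: ys f g h => [//|y ys IH] f g h hE /= [fy fys] [gy gys].
have [|hys ihE] := IH (dirD y f) (dirD y g) (dirD y h) _ fys gys.
  move=> x /set_mem Ox; have [a fa] := fy _ Ox; have [b gb] := gy _ Ox.
  by rewrite (dirDE fa) (dirDE gb); apply: dirDE; exact: is_dirD_lincomb hE _ fa gb.
split => //; split => // x Ox.
have [a fa] := fy _ Ox; have [b gb] := gy _ Ox.
by exists (c *: a + b); exact: is_dirD_lincomb hE _ fa gb.
Qed.

Lemma iter_dirD0 (h : 'rV[R]_n -> E) ys : {in O, h =1 (fun=> 0)} ->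
  iter_derivable O h ys /\ {in O, iter_dirD h ys =1 (fun=> 0)}.
Proof.
elim: ys h => [//|y ys IH] h h0 /=.
have h' x : O x -> is_dirD h y x 0.
  have d0 : is_dirD (fun=> 0 : E) y x 0.
    rewrite /is_dirD; under eq_fun do rewrite subrr scaler0.
    exact: cvg_cst.
  move=> Ox; have : is_dirD h y x (0 *: 0 + 0).
    apply: (is_dirD_lincomb _ Ox d0 d0) => z Oz.
    by rewrite h0// scaler0 addr0.
  by rewrite scaler0 addr0.
have [|h1 h2] := IH (dirD y h).
  by move=> x /set_mem Ox; apply: dirDE; exact: h'.
by split => //; split => // x Ox; exists 0; exact: h'.
Qed.

End linear_combinations.

Section Ck.
Context {R : realType} {E : hausdorffTvsType R} {n : nat}.
Context (k : option nat) (U : set 'rV[R]_n).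
Implicit Types (f : U -> E).

(* Derivatives are only taken at points of U°, where they do not depend on the
   extension of f by 0 outside of U. *)
Definition ext0 f : 'rV[R]_n -> E := 'valL_ (0 : E) f.

Definition is_Ck f : Prop :=
  continuous f /\
  forall l, (0 < l)%N -> leq_ext l k ->
  [/\ forall Y : 'M[R]_(l, n), iter_derivable U° (ext0 f) (rows Y),
      {within U° `*` [set: 'M[R]_(l, n)], continuous (dl (ext0 f))} &
      exists2 h : U * 'M[R]_(l, n) -> E, continuous h &
        forall (x : U) Y, U° (val x) -> h (x, Y) = dl (ext0 f) (val x, Y)].

(* When U has dense interior, there is at most one continuous extension. *)
Definition partial (a : mindex n) f : U -> E :=
  xget (0 : U -> E) [set h | continuous h /\
    forall x : U, U° (val x) -> h x = iter_partial a (ext0 f) (val x)].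

Lemma ext0E f (x : U) : ext0 f (val x) = f x.
Proof. by have /(congr1 (@^~ x)) := valLK (0 : E) f. Qed.

Lemma is_Ck0 : is_Ck 0.
Proof.
have e0 : {in (U° : set 'rV[R]_n), ext0 (0 : U -> E) =1 (fun=> 0)}.
  move=> x /set_mem /interior_subset Ux.
  by rewrite -[x]/(val (SigSub (mem_set Ux) : U)) ext0E.
split; first exact: cst_continuous.
move=> l l0 lk; split => [Y||].
- exact: (iter_dirD0 (@open_interior _ U) _ e0).1.
- apply: (@subspace_eq_continuous _ _ _ (fun=> 0 : E)); last first.
    by move=> ?; exact: cvg_cst.
  move=> p /set_mem [/= Up _].
  by rewrite [RHS](iter_dirD0 (@open_interior _ U) _ e0).2// inE.
- exists (fun=> 0); first exact: cst_continuous.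
  by move=> x Y Ux; rewrite [RHS](iter_dirD0 (@open_interior _ U) _ e0).2// inE.
Qed.

Lemma is_Ck_lincomb (c : R) f g : is_Ck f -> is_Ck g -> is_Ck (c *: f + g).
Proof.
move=> [fc fk] [gc gk].
have e x : U x -> ext0 (c *: f + g) x = c *: ext0 f x + ext0 g x.
  by move=> Ux; rewrite -[x]/(val (SigSub (mem_set Ux) : U)) !ext0E.
have ei : {in (U° : set 'rV[R]_n), ext0 (c *: f + g) =1 (fun x => c *: ext0 f x + ext0 g x)}.
  by move=> x /set_mem /interior_subset; exact: e.
split; first by move=> x; exact: (cvg_lincomb (fc x) (gc x)).
move=> l l0 lk; have [fd fl [fh fhc fhE]] := fk _ l0 lk.
have [gd gl [gh ghc ghE]] := gk _ l0 lk.
have dE x (Y : 'M[R]_(l, n)) : U° x ->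
    dl (ext0 (c *: f + g)) (x, Y) = c *: dl (ext0 f) (x, Y) + dl (ext0 g) (x, Y).
  move=> Ux.
  by rewrite /dl (iter_dirD_lincomb (@open_interior _ U) ei (fd Y) (gd Y)).2// inE.
split => [Y||].
- exact: (iter_dirD_lincomb (@open_interior _ U) ei (fd Y) (gd Y)).1.
- apply: (@subspace_eq_continuous _ _ _
    (fun p => c *: dl (ext0 f) p + dl (ext0 g) p)).
    by move=> [x Y] /set_mem [/= Ux _]; rewrite [RHS]dE.
  by move=> p; exact: (cvg_lincomb (fl p) (gl p)).
- exists (fun p => c *: fh p + gh p).
    by move=> p; exact: (cvg_lincomb (fhc p) (ghc p)).
  by move=> x Y Ux; rewrite fhE// ghE// dE.
Qed.

Definition Ck_pred : {pred U -> E} := fun f => `[< is_Ck f >].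

Lemma Ck_submod_closed : submod_closed Ck_pred.
Proof.
split=> [|c f g /asboolP fk /asboolP gk]; apply/asboolP; first exact: is_Ck0.
exact: is_Ck_lincomb.
Qed.

HB.instance Definition _ :=
  GRing.isSubmodClosed.Build R (U -> E) Ck_pred Ck_submod_closed.

End Ck.

Section Ck_space.
Context {R : realType} {n : nat}.
Context (k : option nat) (U : set 'rV[R]_n) (E : hausdorffTvsType R).

Record Ck := MkCk { Ck_val :> U -> E; _ : Ck_val \in Ck_pred k (U := U) }.

HB.instance Definition _ := [isSub for Ck_val].
HB.instance Definition _ := [Choice of Ck by <:].
HB.instance Definition _ := [SubChoice_isSubLmodule of Ck by <:].

(* The suprema are finite, as partial a f is continuous when |a| <= k; the
   supremum over the empty set is 0. *)
Definition Ck_seminorm (l : nat) (q : E -> R) (K : set U) (f : Ck) : R :=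
  \big[Num.max/0]_(a <- mindices n l) sup [set q (partial a f x) | x in K].

Definition Ck_seminorms : set (Ck -> R) :=
  [set p | exists l q K, [/\ leq_ext l k, cont_seminorm q, compact K &
    p = Ck_seminorm l q K]].

HB.instance Definition _ := Topological.copy Ck (seminormed Ck_seminorms).

End Ck_space.

Section jets.
Context {R : realType} {n : nat}.
Context (k : option nat) (U : set 'rV[R]_n) (E : tvsType R).

Definition jet := kmindex n k -> U -> E.

HB.instance Definition _ := GRing.Lmodule.copy jet (kmindex n k -> U -> E).

Implicit Types (F G : jet) (x y : U) (a : mindex n).

(* f_a, set to 0 when |a| > k *)
Definition jcoef F a : U -> E := if insub a is Some b then F b else 0.

(* R_y^(l - |a|) d^a F (x) *)
Definition remainder F (l : nat) a y x : E :=
  jcoef F a x - \sum_(b <- mindices n (l - msize a))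
    (mpow (val x - val y) b / (mfact b)%:R) *: jcoef F (a + b) y.

Definition is_whitney F : Prop :=
  forall (l : nat) a (q : E -> R) (K : set U) (e : R),
    leq_ext l k -> (msize a <= l)%N -> cont_seminorm q -> compact K -> 0 < e ->
    exists2 d : R, 0 < d & forall x y, K x -> K y ->
      0 < enorm (val x - val y) < d ->
      q (remainder F l a y x) <= e * enorm (val x - val y) ^+ (l - msize a).

Lemma remainder_lincomb c F G l a y x : remainder (c *: F + G) l a y x =
  c *: remainder F l a y x + remainder G l a y x.
Proof.
have jE b z : jcoef (c *: F + G) b z = c *: jcoef F b z + jcoef G b z.
  rewrite /jcoef; case: insub => [//|]; by rewrite scaler0 addr0.
rewrite /remainder jE scalerBr addrACA -opprD scaler_sumr -big_split/=.
congr (_ - _); apply: eq_bigr => b _.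
by rewrite jE scalerDr !scalerA [_ * c]mulrC.
Qed.

Lemma remainder0 l a y x : remainder 0 l a y x = 0.
Proof.
have jE b z : jcoef 0 b z = 0 by rewrite /jcoef; case: insub.
by rewrite /remainder jE big1 ?subr0// => b _; rewrite jE scaler0.
Qed.

Definition whitney_pred : {pred jet} := fun F => `[< is_whitney F >].

Lemma whitney_submod_closed : submod_closed whitney_pred.
Proof.
split=> [|c F G /asboolP Fk /asboolP Gk]; apply/asboolP.
  move=> l a q K e lk al [_ qZ _] cK e0; exists 1 => // x y _ _ _.
  rewrite remainder0 -(scale0r (0 : E)) qZ normr0 mul0r.
  by rewrite mulr_ge0 ?(ltW e0)// exprn_ge0// sqrtr_ge0.
move=> l a q K e lk al qs cK e0; have [qD qZ _] := qs.
have c1 : 0 < `|c| + 1 by rewrite ltr_wpDl.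
have e2 : 0 < e / 2 by rewrite divr_gt0.
have [d d0 Fd] := Fk l a q K (e / 2 / (`|c| + 1)) lk al qs cK (divr_gt0 e2 c1).
have [d' d'0 Gd] := Gk l a q K (e / 2) lk al qs cK e2.
exists (Num.min d d'); first by rewrite lt_min d0.
move=> x y Kx Ky /andP[xy]; rewrite lt_min => /andP[xyd xyd'].
rewrite remainder_lincomb (le_trans (qD _ _))// qZ.
rewrite [X in _ <= X * _]splitr mulrDl lerD//; last by apply: Gd => //; rewrite xy.
have /= := Fd _ _ Kx Ky; rewrite xy xyd => /(_ isT) Fxy.
rewrite (le_trans (ler_wpM2l (normr_ge0 c) Fxy))// mulrA ler_wpM2r//.
  by rewrite exprn_ge0// sqrtr_ge0.
by rewrite mulrCA ger_pMr// ler_pdivrMr// mul1r lerDl.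
Qed.

HB.instance Definition _ :=
  GRing.isSubmodClosed.Build R jet whitney_pred whitney_submod_closed.

End jets.

Section whitney_space.
Context {R : realType} {n : nat}.
Context (k : option nat) (U : set 'rV[R]_n) (E : tvsType R).

Record whitney := MkWhitney {
  whitney_val :> jet k U E; _ : whitney_val \in @whitney_pred R n k U E }.

HB.instance Definition _ := [isSub for whitney_val].
HB.instance Definition _ := [Choice of whitney by <:].
HB.instance Definition _ := [SubChoice_isSubLmodule of whitney by <:].

(* As for Ck_seminorm, all the suprema in this section are taken over bounded
   sets of reals (possibly empty, with supremum 0). *)
Definition whitney_seminorm' (l : nat) (q : E -> R) (K : set U)
    (F : whitney) : R :=
  \big[Num.max/0]_(a <- mindices n l) sup [set q (jcoef F a x) | x in K].

Definition whitney_seminorm (l : nat) (q : E -> R) (K : set U)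
    (F : whitney) : R :=
  whitney_seminorm' l q K F +
  \big[Num.max/0]_(a <- mindices n l)
    sup [set r | exists x y, [/\ K x, K y, x != y &
      r = q (remainder F l a y x) / enorm (val x - val y) ^+ (l - msize a)]].

Definition whitney_seminorms : set (whitney -> R) :=
  [set p | exists l q K, [/\ leq_ext l k, cont_seminorm q, compact K &
    p = whitney_seminorm l q K]].

Definition whitney_seminorms' : set (whitney -> R) :=
  [set p | exists l q K, [/\ leq_ext l k, cont_seminorm q, compact K &
    p = whitney_seminorm' l q K]].

HB.instance Definition _ :=
  Topological.copy whitney (seminormed whitney_seminorms).

End whitney_space.

(* Main.v *)
Require Import Defs.
From HB Require Import structures.
From mathcomp Require Import all_boot all_order all_algebra.
From mathcomp Require Import all_classical all_reals all_analysis.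
From mathcomp Require Import ring lra.
Import Order.TTheory GRing.Theory Num.Theory.
Import numFieldNormedType.Exports.
Set Implicit Arguments.
Unset Strict Implicit.
Unset Printing Implicit Defensive.
Local Open Scope classical_set_scope.
Local Open Scope ring_scope.

(** Both spaces consist of families of functions G_a, |a| <= k, which are
   continuous on U and satisfy D_v G_a = sum_i v_i G_(a + e_i) on the interior U°
   of U (derivative_family).

   The derivatives of a C^k-function f form such a family (Ck_derivative_family):
   mixed derivatives commute by Schwarz' theorem (schwarz), and D_v is linear in v
   (is_dirD_sum). Conversely, G_0 is a C^k-function with derivatives G_a
   (family_is_Ck, family_partial).

   A Whitney jet is such a family by its conditions of orders |a| and |a| + 1
   (whitney_family). The converse (family_whitney) is the heart of the matter.
   Small balls of U are convex and U° is dense in U, so that the mean value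
   inequality passes from U° to U: the G_a are differentiable along all segments
   of U, even those in the boundary (strict_derivative). By induction on m, the
   Taylor remainder of order m of G_a satisfies, for a segment [y, x] in U and
   a continuous seminorm q (taylor_estimate),
     q (R_y^m G_a (x)) <= (n |x - y|)^m sup q (G_b (z) - G_b (y)),
   where z ranges over [y, x] and b over the multi-indices with |b| = |a| + m.

   Hence f |-> (d^a f)_a is a bijection with inverse (f_a)_a |-> f_0. The inverse
   is continuous as the seminorms of C^k are dominated by those of jets. For the
   continuity of the map itself, the Taylor estimate bounds the quotients in the
   Whitney seminorm on a compact set K by suprema of the f_a over a larger compact
   set, which contains the segments between nearby points of K
   (whitney_seminorm_estimate). The same estimate shows that these suprema
   generate the topology on the space of jets.

   All estimates are made for a fixed continuous seminorm of E; as E is locally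
   convex, these seminorms determine its limits (nbhs0_seminorm, cvg_seminorm). *)

(** * Continuous seminorms of a locally convex space *)

Section seminorm_theory.
Context {R : realType} {E : tvsType R} (q : E -> R) (qs : cont_seminorm q).

Lemma seminormZ c x : q (c *: x) = `|c| * q x.
Proof. by case: qs. Qed.

Lemma seminormD x y : q (x + y) <= q x + q y.
Proof. by case: qs. Qed.

Lemma seminorm0 : q 0 = 0.
Proof. by rewrite -(scale0r (0 : E)) seminormZ normr0 mul0r. Qed.

Lemma seminormN x : q (- x) = q x.
Proof. by rewrite -scaleN1r seminormZ normrN normr1 mul1r. Qed.

Lemma seminorm_ge0 x : 0 <= q x.
Proof.
have := seminormD x (- x); rewrite subrr seminorm0 seminormN.
by rewrite -mulr2n pmulrn_lge0.
Qed.

Lemma seminormBC x y : q (x - y) = q (y - x).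
Proof. by rewrite -seminormN opprB. Qed.

Lemma seminormB x y : q (x - y) <= q x + q y.
Proof. by rewrite -(seminormN y) seminormD. Qed.

Lemma seminorm_tri y x z : q (x - z) <= q (x - y) + q (y - z).
Proof. by rewrite -[x - z](subrKA y) seminormD. Qed.

Lemma seminorm_sum (I : Type) (s : seq I) (P : pred I) (F : I -> E) :
  q (\sum_(i <- s | P i) F i) <= \sum_(i <- s | P i) q (F i).
Proof.
elim/big_ind2 : _ => [|x a y b xa yb|//]; first by rewrite seminorm0.
by rewrite (le_trans (seminormD _ _))// lerD.
Qed.

End seminorm_theory.

Section minkowski.
Context {R : realType} {E : tvsType R}.

Lemma convex_setP (M : lmodType R) (A : set M) : convex_set A <->
  forall x y t, A x -> A y -> 0 <= t <= 1 -> A (t *: x + (1 - t) *: y).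
Proof.
split=> [cA x y t Ax Ay t01|cA x y t /set_mem Ax /set_mem Ay].
  have := cA x y (Itv01 (andP t01).1 (andP t01).2).
  rewrite !inE => /(_ Ax Ay); congr A.
apply/mem_set; have := cA x y t%:num Ax Ay; apply.
by rewrite ge0 le1.
Qed.

Lemma tvs_cvgD (T : Type) (F : set_system T) {FF : Filter F} (f g : T -> E) (a b : E) :
  f @ F --> a -> g @ F --> b -> f t + g t @[t --> F] --> a + b.
Proof.
exact: (@continuous2_cvg _ _ _ _ _ _ f g (fun u v : E => u + v) a b
  (@add_continuous E (a, b))).
Qed.

Lemma tvs_cvgZ (T : Type) (F : set_system T) {FF : Filter F} (c : T -> R)
    (f : T -> E) (r : R) (a : E) :
  c @ F --> r -> f @ F --> a -> c t *: f t @[t --> F] --> r *: a.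
Proof.
exact: (@continuous2_cvg _ _ _ _ _ _ (c : T -> R^o) f
  (fun (d : R^o) (v : E) => d *: v) (r : R^o) a (@scale_continuous _ E (r, a))).
Qed.

Lemma tvs_cvg_sum (T : Type) (F : set_system T) {FF : Filter F} (I : Type)
    (s : seq I) (f : I -> T -> E) (a : I -> E) :
  (forall i, f i @ F --> a i) ->
  \sum_(i <- s) f i t @[t --> F] --> \sum_(i <- s) a i.
Proof.
move=> fa; elim: s => [|i s IH].
  by rewrite big_nil; under eq_fun do rewrite big_nil; exact: cvg_cst.
by rewrite big_cons; under eq_fun do rewrite big_cons; exact: tvs_cvgD.
Qed.

Let minkowski_gauge (W : set E) (x : E) : R := inf [set t | 0 < t /\ W (t^-1 *: x)].

(** Local convexity of E enters here only: the Minkowski gauge of a convex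
   symmetric neighbourhood of 0 is subadditive. *)
Lemma nbhs0_seminorm (B : set E) : nbhs 0 B ->
  exists2 q : E -> R, cont_seminorm q & [set x | q x < 1] `<=` B.
Proof.
move=> B0; have [b bconv [bopen bbase]] := @locally_convex R E.
have [C [bC C0] CB] := bbase 0 B B0.
have /convex_setP cC := bconv C (mem_set bC).
have nC : nbhs 0 C by apply: open_nbhs_nbhs; split => //; exact: bopen.
pose W := C `&` [set x | C (- x)].
have nW : nbhs 0 W.
  apply: filterI => //.
  have := @opp_continuous E 0 C; rewrite oppr0 => /(_ nC); exact.
have WN x : W x -> W (- x) by case=> ? ?; split => //=; rewrite opprK.
have cW x y t : W x -> W y -> 0 <= t <= 1 -> W (t *: x + (1 - t) *: y).
  move=> [Cx CNx] [Cy CNy] t01; split => /=; first exact: cC.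
  by rewrite opprD -!scalerN; exact: cC.
have W0 : W 0 by exact: nbhs_singleton.
pose S x := [set t | 0 < t /\ W (t^-1 *: x)].
have S0 x : S x !=set0.
  have sx : c *: x @[c --> (0 : R)] --> (0 : E).
    rewrite -[X in _ --> X](scale0r x).
    by apply: tvs_cvgZ; [exact: cvg_id|exact: cvg_cst].
  have /nbhs_ballP[d /= d0 dW] := sx _ nW.
  exists (d / 2)^-1; split; first by rewrite invr_gt0 divr_gt0.
  rewrite invrK; apply: dW; rewrite /ball/= sub0r normrN gtr0_norm ?divr_gt0//.
  by rewrite ltr_pdivrMr// ltr_pMr// ltr1n.
have lS x : has_lbound (S x) by exists 0 => t [/ltW].
have qle x t : S x t -> minkowski_gauge W x <= t by exact: ge_inf.
have qlt x t : minkowski_gauge W x < t -> S x t.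
  move=> /(inf_lt (S0 x))[s [s0 Ws] st].
  have t0 : 0 < t by exact: lt_trans st.
  split => //; have := @cW _ 0 (s / t) Ws W0.
  rewrite scaler0 addr0 scalerA mulrAC divff ?gt_eqF// mul1r; apply.
  by rewrite divr_ge0 ?(ltW s0) ?(ltW t0)// ler_pdivrMr// mul1r ltW.
have qge x c : (forall t, S x t -> c <= t) -> c <= minkowski_gauge W x.
  by move=> h; apply: (lb_le_inf (S0 x)) => t; exact: h.
have q_ge0 x : 0 <= minkowski_gauge W x by apply: qge => t [/ltW].
have qD x y : minkowski_gauge W (x + y) <= minkowski_gauge W x + minkowski_gauge W y.
  rewrite -lerBlDr; apply: (@qge) => s [s0 Ws]; rewrite lerBlDr -lerBlDl.
  apply: qge => t [t0 Wt]; rewrite lerBlDl; apply: qle.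
  have st0 : 0 < s + t by rewrite addr_gt0.
  split => //; have := cW _ _ (s / (s + t)) Ws Wt.
  rewrite -[X in X - _](@divff _ (s + t)) ?gt_eqF// -mulrBl [s + t - s]addrC addKr.
  rewrite !scalerA ![_ / (s + t)]mulrC -!mulrA !divff ?gt_eqF// !mulr1 -scalerDr.
  apply; rewrite mulr_ge0 ?invr_ge0 ?(ltW s0) ?(ltW st0)//=.
  by rewrite mulrC ler_pdivrMr// mul1r lerDl ltW.
have q0 : minkowski_gauge W 0 = 0.
  apply/eqP; rewrite eq_le q_ge0 andbT; apply/ler_addgt0Pr => e e0.
  by rewrite add0r; apply: qle; split; rewrite ?scaler0.
have qZle c x : c != 0 -> minkowski_gauge W (c *: x) <= `|c| * minkowski_gauge W x.
  move=> c0; have nc0 : 0 < `|c| by rewrite normr_gt0.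
  rewrite mulrC -ler_pdivrMr//; apply: qge => t [t0 Wt].
  rewrite ler_pdivrMr//; apply: qle; split; first by rewrite mulr_gt0.
  rewrite scalerA invfM; have [cp|] := boolP (0 < c).
    by rewrite gtr0_norm// -mulrA mulVf// mulr1.
  rewrite -leNgt => cn; rewrite ler0_norm// invrN mulrN mulNr -mulrA mulVf// mulr1.
  by rewrite scaleNr; exact: WN.
have qZ c x : minkowski_gauge W (c *: x) = `|c| * minkowski_gauge W x.
  have [->|c0] := eqVneq c 0; first by rewrite scale0r normr0 mul0r q0.
  apply/eqP; rewrite eq_le qZle//=.
  have nc0 : 0 < `|c| by rewrite normr_gt0.
  have := qZle c^-1 (c *: x); rewrite invr_eq0 => /(_ c0).
  by rewrite scalerA mulVf// scale1r normfV mulrC ler_pdivlMr// mulrC.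
exists (minkowski_gauge W); last first.
  by move=> x /qlt[_]; rewrite invr1 scale1r => -[Cx _]; exact: CB.
split => // x; apply/cvgrPdist_le => e e0.
have nz : \forall z \near (0 : E), minkowski_gauge W z <= e.
  apply: filterS (nbhs0Z (lt0r_neq0 e0) nW) => _ [w Ww <-].
  by apply: qle; split => //; rewrite scalerA mulVf ?gt_eqF// scale1r.
have nz' : \forall y \near x, minkowski_gauge W (y - x) <= e.
  have : y - x @[y --> x] --> x - x.
    by apply: tvs_cvgD; [exact: cvg_id|exact: cvg_cst].
  by rewrite subrr => /(_ _ nz).
have qC u : minkowski_gauge W (- u) = minkowski_gauge W u.
  by rewrite -scaleN1r qZ normrN1 mul1r.
apply: filterS nz' => y yx; rewrite ler_norml.
have h1 : minkowski_gauge W y <= minkowski_gauge W x + minkowski_gauge W (y - x).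
  by have := qD x (y - x); rewrite addrCA subrr addr0.
have h2 : minkowski_gauge W x <= minkowski_gauge W y + minkowski_gauge W (y - x).
  by have := qD y (x - y); rewrite addrCA subrr addr0 -(qC (x - y)) opprB.
by lra.
Qed.

Lemma seminorm_cvg (q : E -> R) (T : Type) (F : set_system T) {FF : Filter F}
    (f : T -> E) (a : E) (e : R) :
  cont_seminorm q -> f @ F --> a -> 0 < e -> \forall t \near F, q (f t - a) < e.
Proof.
move=> qs fa e0; have [_ _ qc] := qs.
have fa0 : f t - a @[t --> F] --> (0 : E).
  rewrite -[X in _ --> X](subrr a).
  by apply: tvs_cvgD => //; exact: cvg_cst.
have qfa : q (f t - a) @[t --> F] --> q 0 by exact: (cvg_comp _ _ fa0 (qc 0)).
move/cvgrPdist_lt : qfa => /(_ e e0); apply: filterS => t /=.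
by rewrite (seminorm0 qs) sub0r normrN; apply: le_lt_trans (ler_norm _).
Qed.

Lemma cvg_seminorm (T : Type) (F : set_system T) {FF : Filter F}
    (f : T -> E) (a : E) :
  (forall q e, cont_seminorm q -> 0 < e -> \forall t \near F, q (f t - a) <= e) ->
  f @ F --> a.
Proof.
move=> h; suff : f t - a @[t --> F] --> (0 : E).
  move=> fa0; have : f t - a + a @[t --> F] --> 0 + a.
    by apply: tvs_cvgD => //; exact: cvg_cst.
  by rewrite add0r; under eq_fun do rewrite subrK.
move=> B /nbhs0_seminorm[q qs qB].
have e0 : 0 < 2^-1 :> R by rewrite invr_gt0.
apply: (@filterS _ F _ _ _ _ (h q _ qs e0)) => t ft.
by apply: qB => /=; rewrite (le_lt_trans ft)// invf_lt1// ltr1n.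
Qed.

End minkowski.

Lemma seminorm_eq0 {R : realType} {E : hausdorffTvsType R} (x : E) :
  (forall q e, cont_seminorm q -> 0 < e -> q x <= e) -> x = 0.
Proof.
move=> h; have : (fun=> x) @ (nbhs (0 : E)) --> (0 : E).
  by apply: cvg_seminorm => q e qs e0; near=> t; rewrite subr0; exact: h.
have : (fun=> x) @ (nbhs (0 : E)) --> x by exact: cvg_cst.
exact: (@cvg_unique E hausdorff_subproof).
Unshelve. all: by end_near. Qed.

(** * Mean value inequality and directional derivatives on open sets *)

Section mean_value.
Context {R : realType} {E : tvsType R} (q : E -> R) (qs : cont_seminorm q).

(** A pointwise Lipschitz bound is a global one: the supremum of the s such that
   q (phi s - phi 0) <= (M + e) s satisfies this inequality as well, and it
   cannot be smaller than 1. *)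
Lemma lipschitz_segment (phi : R -> E) (M : R) :
  (forall c e : R, 0 <= c <= 1 -> 0 < e -> \forall s \near c, 0 <= s <= 1 ->
    q (phi s - phi c) <= (M + e) * `|s - c|) ->
  q (phi 1 - phi 0) <= M.
Proof.
move=> h; apply/ler_addgt0Pr => e e0.
pose A := [set s | 0 <= s <= 1 /\ q (phi s - phi 0) <= (M + e) * s].
have A0 : A 0 by split; rewrite ?lexx ?ler01// subrr (seminorm0 qs) mulr0.
have sA : has_sup A by split; [exists 0|exists 1 => s [/andP[_ ?] _]].
have c0 : 0 <= sup A by exact: (ub_le_sup sA.2).
have c1 : sup A <= 1 by apply: ge_sup; [exists 0|move=> s [/andP[]]].
have c01 : 0 <= sup A <= 1 by rewrite c0.
have [d /= d0 hd] := (nbhs_ballP _ _).1 (h _ _ c01 e0).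
have Ac : A (sup A).
  split => //; have [s As cs] := sup_adherent d0 sA.
  have sc : s <= sup A by exact: (ub_le_sup sA.2).
  have := hd s; rewrite /ball/= ger0_norm ?subr_ge0// ltrBlDr -ltrBlDl.
  move=> /(_ cs) /(_ As.1); rewrite ler0_norm ?subr_le0// opprB => h1.
  rewrite (le_trans (seminorm_tri qs (phi s) _ _))//.
  rewrite (seminormBC qs) (le_trans (lerD h1 As.2))//.
  by rewrite -mulrDr subrK.
have [c_lt1|c_ge1] := ltP (sup A) 1; last first.
  have c_eq1 : sup A = 1 by apply/eqP; rewrite eq_le c1.
  by case: Ac => _; rewrite c_eq1 mulr1.
pose s := Num.min 1 (sup A + d / 2).
have cs : sup A < s by rewrite lt_min c_lt1 ltrDl divr_gt0.
have s01 : 0 <= s <= 1 by rewrite (le_trans c0 (ltW cs)) ge_min lexx.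
have sd : `|s - sup A| < d.
  rewrite gtr0_norm ?subr_gt0// ltrBlDl gt_min; apply/orP; right.
  by rewrite ltrD2l ltr_pdivrMr// ltr_pMr// ltr1n.
suff /(ub_le_sup sA.2) : A s by rewrite leNgt cs.
split => //; have := hd s; rewrite /ball/= distrC => /(_ sd) /(_ s01).
rewrite gtr0_norm ?subr_gt0// => h1.
rewrite (le_trans (seminorm_tri qs (phi (sup A)) _ _))//.
by rewrite (le_trans (lerD h1 Ac.2))// -mulrDr subrK.
Qed.

Lemma mean_value_segment (phi dphi : R -> E) (M : R) :
  (forall c e : R, 0 <= c <= 1 -> 0 < e -> \forall s \near c, 0 <= s <= 1 ->
    q (phi s - phi c - (s - c) *: dphi c) <= e * `|s - c|) ->
  (forall c : R, 0 <= c <= 1 -> q (dphi c) <= M) ->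
  q (phi 1 - phi 0) <= M.
Proof.
move=> h hM; apply: lipschitz_segment => c e c01 e0.
apply: filterS (h c e c01 e0) => s hs s01.
rewrite -[_ - phi c](subrK ((s - c) *: dphi c)) (le_trans (seminormD qs _ _))//.
rewrite addrC mulrDl lerD ?hs// (seminormZ qs) mulrC ler_wpM2r//.
exact: hM.
Qed.

End mean_value.

Section directional_derivative_theory.
Context {R : realType} {E : hausdorffTvsType R} {n : nat}.
Implicit Types (g : 'rV[R]_n -> E) (x y v w : 'rV[R]_n).

Lemma is_dirDP g v x z : is_dirD g v x z <->
  forall (q : E -> R) (e : R), cont_seminorm q -> 0 < e ->
    \forall t \near (0 : R), q (g (x + t *: v) - g x - t *: z) <= e * `|t|.
Proof.
have key q (t : R) : cont_seminorm q -> t != 0 ->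
    q (g (x + t *: v) - g x - t *: z) =
    `|t| * q (t^-1 *: (g (x + t *: v) - g x) - z).
  by move=> qs t0; rewrite -(seminormZ qs) scalerBr scalerA divff// scale1r.
split=> [h q e qs e0|h].
  have : \forall t \near (0 : R)^', q (t^-1 *: (g (x + t *: v) - g x) - z) < e.
    exact: seminorm_cvg.
  rewrite /dnbhs near_withinE; apply: filterS => t ht; have [->|t0] := eqVneq t 0.
    by rewrite !scale0r addr0 subrr subr0 (seminorm0 qs) normr0 mulr0.
  by rewrite key// mulrC ler_wpM2r// ltW// ht.
apply: cvg_seminorm => q e qs e0; rewrite /dnbhs near_withinE.
apply: filterS (h q e qs e0) => t + t0; rewrite key// mulrC ler_pM2r//.
by rewrite normr_gt0.
Qed.

Lemma is_dirDZ g v x z (a : R) : is_dirD g v x z -> is_dirD g (a *: v) x (a *: z).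
Proof.
move=> /is_dirDP h; apply/is_dirDP => q e qs e0.
have a1 : 0 < `|a| + 1 by rewrite ltr_wpDl.
have ta : t * a @[t --> (0 : R)] --> (0 : R).
  by rewrite -[X in _ --> X](mul0r a); apply: cvgMl; exact: cvg_id.
apply: (@filterS _ (nbhs (0 : R)) _ _ _ _ (ta _ (h q _ qs (divr_gt0 e0 a1)))).
move=> t; rewrite /= !scalerA => /le_trans; apply.
rewrite normrM mulrCA mulrC ler_wpM2r// -mulrA ger_pMr//.
by rewrite mulrC ler_pdivrMr// mul1r lerDl.
Qed.

Lemma is_dirD_near g h v x z : (\forall y \near x, g y = h y) ->
  is_dirD g v x z -> is_dirD h v x z.
Proof.
move=> gh /is_dirDP gz; apply/is_dirDP => q e qs e0.
have xv : x + t *: v @[t --> (0 : R)] --> x.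
  have : x + t *: v @[t --> (0 : R)] --> x + 0 *: v.
    by apply: cvgD; [exact: cvg_cst|apply: cvgZr_tmp; exact: cvg_id].
  by rewrite scale0r addr0.
apply: (@filterS2 _ (nbhs (0 : R)) _ _ _ _ _ (xv _ gh) (gz q e qs e0)) => t /= <-.
by rewrite (nbhs_singleton gh).
Qed.

Lemma dirD_near g h v x : (\forall y \near x, g y = h y) -> dirD v g x = dirD v h x.
Proof.
move=> gh; rewrite /dirD; congr xget; apply/seteqP; split=> z.
  exact: is_dirD_near.
by apply: is_dirD_near; apply: filterS gh => y ->.
Qed.

Lemma eq_in_iter_dirD (O : set 'rV[R]_n) g h ys : open O -> {in O, g =1 h} ->
  {in O, iter_dirD g ys =1 iter_dirD h ys}.
Proof.
move=> oO; elim: ys g h => [//|y ys IH] g h gh /=; apply: IH => x /set_mem Ox.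
apply: dirD_near; have : nbhs x O by exact: open_nbhs_nbhs.
by apply: filterS => z Oz; rewrite gh// inE.
Qed.

Lemma dirD_mean_value q g (G : 'rV[R]_n -> E) v x z M : cont_seminorm q ->
  (forall s, 0 <= s <= 1 -> is_dirD g v (x + s *: v) (G (x + s *: v))) ->
  (forall s, 0 <= s <= 1 -> q (G (x + s *: v) - z) <= M) ->
  q (g (x + v) - g x - z) <= M.
Proof.
move=> qs gG GM.
have := @mean_value_segment _ _ q qs (fun s => g (x + s *: v) - s *: z)
  (fun s => G (x + s *: v) - z) M.
rewrite !scale1r !scale0r subr0 addr0 -addrA [- z - _]addrC addrA; apply => //.
move=> c e c01 e0; have /is_dirDP gc := gG c c01.
have sc : s - c @[s --> c] --> (0 : R).
  by rewrite -[X in _ --> X](subrr c); apply: cvgB; [exact: cvg_id|exact: cvg_cst].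
apply: (@filterS _ (nbhs c) _ _ _ _ (sc _ (gc q e qs e0))) => s /= h _.
apply: le_trans h.
rewrite -[x + _ + (s - c) *: v]addrA -scalerDl subrKC.
by rewrite opprD addrACA -opprD -scalerBl scalerBr opprB subrKA.
Qed.

Lemma nbhs_norm_lt x (P : set 'rV[R]_n) : nbhs x P ->
  exists2 r, 0 < r & forall y, `|y - x| < r -> P y.
Proof.
move=> /nbhs_ballP[r /= r0 rP]; exists r => // y yx.
by apply: rP; rewrite -ball_normE /= distrC.
Qed.

Lemma near0_norm_lt v w (r : R) : 0 < r ->
  \forall t \near (0 : R), `|t| * (`|v| + `|w|) < r.
Proof.
move=> r0; have vw0 : 0 < `|v| + `|w| + 1 by rewrite ltr_wpDl// addr_ge0.
have : \forall t \near (0 : R), `|t| < r / (`|v| + `|w| + 1).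
  apply/nbhs_ballP; exists (r / (`|v| + `|w| + 1)); first exact: divr_gt0.
  by move=> t; rewrite /ball/= sub0r normrN.
apply: filterS => t; rewrite ltr_pdivlMr//; apply: le_lt_trans.
by rewrite ler_wpM2l// lerDl.
Qed.

Lemma scaled_norm_lt v w (r t s s' : R) : `|t| * (`|v| + `|w|) < r ->
  0 <= s <= 1 -> 0 <= s' <= 1 -> `|s *: (t *: v) + s' *: (t *: w)| < r.
Proof.
move=> tr s01 s'01; apply: le_lt_trans tr; rewrite mulrDr.
have h u (c : R) : 0 <= c <= 1 -> `|c *: (t *: u)| <= `|t| * `|u|.
  move=> /andP[c0 c1]; rewrite !normrZ ger0_norm// mulrCA.
  by rewrite ler_wpM2l// ler_piMl.
by rewrite (le_trans (ler_normD _ _))// lerD// h.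
Qed.

(** The increment of g from x + t v to x + t v + t w is t G(x) up to o(t) by the
   mean value inequality, G being continuous at x. *)
Lemma is_dirD_addr g (G : 'rV[R]_n -> E) v w x a :
  is_dirD g v x a -> (\forall y \near x, is_dirD g w y (G y)) ->
  G @ x --> G x -> is_dirD g (v + w) x (a + G x).
Proof.
move=> /is_dirDP gv gw Gx; apply/is_dirDP => q e qs e0.
have e20 : 0 < e / 2 by rewrite divr_gt0.
have /nbhs_norm_lt[r r0 hr] : \forall y \near x, is_dirD g w y (G y) /\
    q (G y - G x) < e / 2.
  by near=> y; split; near: y => //; exact: seminorm_cvg.
apply: (@filterS2 _ (nbhs (0 : R)) _ _ _ _ _ (near0_norm_lt v w r0)
  (gv q _ qs e20)) => t tr gvt.
have in_r s : 0 <= s <= 1 -> `|x + t *: v + s *: (t *: w) - x| < r.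
  move=> s01; rewrite -[x + _ + _]addrA [x + _]addrC addrK -[t *: v]scale1r.
  by apply: scaled_norm_lt => //; rewrite ler01 lexx.
have := @dirD_mean_value q g (fun y => t *: G y) (t *: w) (x + t *: v) (t *: G x)
  (`|t| * (e / 2)) qs.
have h1 s : 0 <= s <= 1 -> is_dirD g (t *: w) (x + t *: v + s *: (t *: w))
    (t *: G (x + t *: v + s *: (t *: w))).
  by move=> s01; apply: is_dirDZ; have [] := hr _ (in_r s s01).
have h2 s : 0 <= s <= 1 -> q (t *: G (x + t *: v + s *: (t *: w)) - t *: G x)
    <= `|t| * (e / 2).
  move=> s01; rewrite -scalerBr (seminormZ qs) ler_wpM2l// ltW//.
  by have [] := hr _ (in_r s s01).
move=> /(_ h1 h2) gwt; rewrite scalerDr addrA.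
set g1 := g (x + t *: v) in gvt gwt; set g2 := g (_ + _) in gwt *.
rewrite [X in q X <= _](_ : _ = (g2 - g1 - t *: G x) + (g1 - g x - t *: a)).
  rewrite (le_trans (seminormD qs _ _))// [e]splitr mulrDl lerD//.
  by rewrite mulrC.
by rewrite scalerDr [RHS]addrACA subrKA -opprD [X in _ - X = _]addrC.
Unshelve. all: by end_near. Qed.

End directional_derivative_theory.

(** * Symmetry of higher directional derivatives *)

Section symmetry.
Context {R : realType} {E : hausdorffTvsType R} {n : nat}.
Implicit Types (g : 'rV[R]_n -> E) (x y v w : 'rV[R]_n) (O : set 'rV[R]_n).

(** Half of Schwarz' theorem: the second difference of g is t^2 D_w D_v g (x)
   up to o(t^2), by the mean value inequality applied first in direction v to
   y |-> g (y + t w) - g y and then in direction w to D_v g. *)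
Lemma second_difference g (A B : 'rV[R]_n -> E) v w x q e :
  cont_seminorm q -> 0 < e ->
  (\forall y \near x, is_dirD g v y (A y) /\ is_dirD A w y (B y)) ->
  B @ x --> B x ->
  \forall t \near (0 : R),
    q (g (x + t *: v + t *: w) - g (x + t *: v) - (g (x + t *: w) - g x) -
       (t * t) *: B x) <= `|t| * (`|t| * e).
Proof.
move=> qs e0 gAB Bx.
have /nbhs_norm_lt[r r0 hr] : \forall y \near x,
    (is_dirD g v y (A y) /\ is_dirD A w y (B y)) /\ q (B y - B x) < e.
  by near=> y; split; near: y => //; exact: seminorm_cvg.
apply: (@filterS _ (nbhs (0 : R)) _ _ _ _ (near0_norm_lt v w r0)) => t tr.
have in_r (s s' : R) : 0 <= s <= 1 -> 0 <= s' <= 1 ->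
    `|x + s *: (t *: v) + s' *: (t *: w) - x| < r.
  by move=> ? ?; rewrite -[x + _ + _]addrA [x + _]addrC addrK; exact: scaled_norm_lt.
have o0 : 0 <= (0 : R) <= 1 by rewrite lexx ler01.
have o1 : 0 <= (1 : R) <= 1 by rewrite lexx ler01.
have step s : 0 <= s <= 1 ->
    q (t *: A (x + s *: (t *: v) + t *: w) - t *: A (x + s *: (t *: v)) -
       (t * t) *: B x) <= `|t| * (`|t| * e).
  move=> s01; rewrite -scalerA -!scalerBr (seminormZ qs) ler_wpM2l//.
  apply: (@dirD_mean_value _ _ _ q A (fun y => t *: B y)) => // s' s'01.
    by apply: is_dirDZ; have [[]] := hr _ (in_r s s' s01 s'01).
  rewrite -scalerBr (seminormZ qs) ler_wpM2l// ltW//.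
  by have [] := hr _ (in_r s s' s01 s'01).
have := @dirD_mean_value _ _ _ q (fun y => g (y + t *: w) - g y)
  (fun y => t *: A (y + t *: w) - t *: A y) (t *: v) x ((t * t) *: B x)
  (`|t| * (`|t| * e)) qs.
apply => // s s01.
have d0 : is_dirD g (t *: v) (x + s *: (t *: v)) (t *: A (x + s *: (t *: v))).
  apply: is_dirDZ; have := hr _ (in_r s 0 s01 o0).
  by rewrite scale0r addr0 => -[[]].
have d1 : is_dirD (fun y => g (y + t *: w)) (t *: v) (x + s *: (t *: v))
    (t *: A (x + s *: (t *: v) + t *: w)).
  have : is_dirD g (t *: v) (x + s *: (t *: v) + t *: w)
      (t *: A (x + s *: (t *: v) + t *: w)).
    apply: is_dirDZ; have := hr _ (in_r s 1 s01 o1).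
    by rewrite scale1r => -[[]].
  by rewrite /is_dirD; under eq_fun do rewrite addrAC.
have := @is_dirD_lincomb _ _ _ setT openT (-1) g (fun y => g (y + t *: w))
  (fun y => g (y + t *: w) - g y) (t *: v) (x + s *: (t *: v)) _ _ _ I d0 d1.
rewrite scaleN1r [- _ + _]addrC; apply.
by move=> y _; rewrite scaleN1r addrC.
Unshelve. all: by end_near. Qed.

Lemma schwarz g (A A' B B' : 'rV[R]_n -> E) v w x :
  (\forall y \near x, is_dirD g v y (A y) /\ is_dirD A w y (B y)) ->
  (\forall y \near x, is_dirD g w y (A' y) /\ is_dirD A' v y (B' y)) ->
  B @ x --> B x -> B' @ x --> B' x -> B x = B' x.
Proof.
move=> gAB gAB' Bx B'x; apply/eqP; rewrite -subr_eq0; apply/eqP.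
apply: seminorm_eq0 => q e qs e0.
have e20 : 0 < e / 2 by rewrite divr_gt0.
have : \forall t \near (0 : R)^', t != 0 /\ q (B x - B' x) <= e.
  near=> t; have t0 : t != 0 by near: t; exact: nbhs_dnbhs_neq.
  split=> //; have nt0 : 0 < `|t| by rewrite normr_gt0.
  rewrite -(ler_pM2l nt0) -(ler_pM2l nt0) -!(seminormZ qs) scalerA scalerBr.
  have h1 : q (g (x + t *: v + t *: w) - g (x + t *: v) -
       (g (x + t *: w) - g x) - (t * t) *: B x) <= `|t| * (`|t| * (e / 2)).
    by near: t; apply: nbhs_dnbhs; exact: second_difference gAB Bx.
  have h2 : q (g (x + t *: w + t *: v) - g (x + t *: w) -
       (g (x + t *: v) - g x) - (t * t) *: B' x) <= `|t| * (`|t| * (e / 2)).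
    by near: t; apply: nbhs_dnbhs; exact: second_difference gAB' B'x.
  have {}h2 : q (g (x + t *: v + t *: w) - g (x + t *: v) -
       (g (x + t *: w) - g x) - (t * t) *: B' x) <= `|t| * (`|t| * (e / 2)).
    have swap (a b c d : E) : a - b - (c - d) = a - c - (b - d).
      by rewrite !opprB addrC [RHS]addrC addrACA [RHS]addrACA [- c - b]addrC.
    by rewrite swap [x + t *: v + _]addrAC.
  rewrite (le_trans (seminorm_tri qs (g (x + t *: v + t *: w) - g (x + t *: v) -
       (g (x + t *: w) - g x)) _ _))// [leRHS]mulrA [e in leRHS]splitr mulrDr.
  by rewrite -!mulrA lerD// (seminormBC qs).
by move=> /filter_ex[t []].
Unshelve. all: by end_near. Qed.

(** Continuity is required in the point only, for fixed directions; joint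
   continuity would be cumbersome to inherit from g to its derivatives. *)
Definition smooth_on O (m : nat) g := forall ys, (size ys <= m)%N ->
  iter_derivable O g ys /\
  forall x, O x -> iter_dirD g ys @ x --> iter_dirD g ys x.

Section smooth_on.
Variables (O : set 'rV[R]_n) (oO : open O).

Lemma smooth_cvg m g x : smooth_on O m g -> O x -> g @ x --> g x.
Proof. by move=> gm; have [_] := gm [::] (leq0n _); apply. Qed.

Lemma smooth_dirD m g v : smooth_on O m.+1 g -> smooth_on O m (dirD v g).
Proof. by move=> gm ys ysm; have [[_ h]] := gm (v :: ys) ysm. Qed.

Lemma smooth_is_dirD m g v x : smooth_on O m.+1 g -> O x ->
  is_dirD g v x (dirD v g x).
Proof.
move=> gm Ox; have [[gv _] _] := gm [:: v] isT; have [z gz] := gv _ Ox.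
by rewrite (dirDE gz).
Qed.

Lemma dirDC m g v w : smooth_on O m.+2 g ->
  {in O, dirD v (dirD w g) =1 dirD w (dirD v g)}.
Proof.
move=> gm x /set_mem Ox.
have nO : \forall y \near x, O y by exact: open_nbhs_nbhs.
apply: (@schwarz g (dirD w g) (dirD v g) (dirD v (dirD w g))
  (dirD w (dirD v g)) w v).
- apply: filterS nO => y Oy; split; first exact: (smooth_is_dirD gm Oy).
  exact: (smooth_is_dirD (smooth_dirD _ gm) Oy).
- apply: filterS nO => y Oy; split; first exact: (smooth_is_dirD gm Oy).
  exact: (smooth_is_dirD (smooth_dirD _ gm) Oy).
- exact: (smooth_cvg (smooth_dirD _ (smooth_dirD _ gm)) Ox).
- exact: (smooth_cvg (smooth_dirD _ (smooth_dirD _ gm)) Ox).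
Qed.

Lemma iter_dirD_move g ys v zs : smooth_on O (size ys + size zs).+1 g ->
  {in O, iter_dirD g (ys ++ v :: zs) =1 iter_dirD g (v :: ys ++ zs)}.
Proof.
elim: ys g => [//|y ys IH] g gm x Ox.
apply: (etrans (IH (dirD y g) (smooth_dirD y gm) x Ox)).
exact: (@eq_in_iter_dirD _ _ _ O (dirD v (dirD y g)) (dirD y (dirD v g)) (ys ++ zs)
  oO (@dirDC _ g v y gm)).
Qed.

Lemma iter_dirD_perm g ys zs : perm_eq ys zs -> smooth_on O (size ys) g ->
  {in O, iter_dirD g ys =1 iter_dirD g zs}.
Proof.
elim: ys zs g => [|y ys IH] zs g; first by rewrite perm_sym => /perm_nilP ->.
move=> yzs gm x Ox.
have yz : y \in zs by rewrite -(perm_mem yzs) mem_head.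
move: yzs; case/splitPr : yz => z1 z2 yzs.
have {}yzs : perm_eq ys (z1 ++ z2).
  rewrite -(perm_cons y) (perm_trans yzs)// -[y :: z2]cat1s.
  by rewrite (permEl (perm_catCA _ _ _)).
have sz : size ys = (size z1 + size z2)%N by rewrite (perm_size yzs) size_cat.
rewrite /= sz in gm; apply: (etrans _ (esym (iter_dirD_move y gm Ox))).
by apply: (IH _ _ yzs) => //; rewrite sz; exact: smooth_dirD.
Qed.

(** Linearity of D_v g (x) in v. *)
Lemma is_dirD_sum m g v x : smooth_on O m.+1 g -> O x ->
  is_dirD g v x (\sum_i v 0 i *: dirD (delta_mx 0 i) g x).
Proof.
move=> gm Ox; rewrite [X in is_dirD _ X](row_sum_delta v).
have nO : \forall y \near x, O y by exact: open_nbhs_nbhs.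
elim/big_rec2 : _ => [|i z u _ gu].
  have := @is_dirDZ _ _ _ g 0 x _ 0 (@smooth_is_dirD m g 0 x gm Ox).
  by rewrite !scale0r.
rewrite addrC [X in is_dirD _ _ _ X]addrC.
apply: (@is_dirD_addr _ _ _ g
  (fun y => v 0 i *: dirD (delta_mx 0 i) g y)) => //.
- by apply: filterS nO => y Oy; apply: is_dirDZ; exact: (smooth_is_dirD gm Oy).
- apply: (@tvs_cvgZ _ _ _ (nbhs x) _ (fun=> v 0 i)); first exact: cvg_cst.
  exact: (smooth_cvg (smooth_dirD _ gm) Ox).
Qed.

End smooth_on.
End symmetry.

(** * Multi-indices *)

Section multi_index_theory.
Context {n : nat}.
Implicit Types (a b : mindex n) (i j : 'I_n).

Definition munit i : mindex n := [ffun j => (j == i) : nat].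

Lemma mindexDE a b i : (a + b) i = (a i + b i)%N.
Proof. by rewrite ffunE. Qed.

Lemma munitE i j : munit i j = (j == i) :> nat.
Proof. by rewrite ffunE. Qed.

Lemma msizeD a b : msize (a + b) = (msize a + msize b)%N.
Proof. by rewrite /msize -big_split; apply: eq_bigr => i _; rewrite ffunE. Qed.

Lemma msize_munit i : msize (munit i) = 1%N.
Proof.
rewrite /msize (bigD1 i)//= ffunE eqxx big1// => j ji.
by rewrite ffunE (negbTE ji).
Qed.

Lemma msizeS a i : msize (a + munit i) = (msize a).+1.
Proof. by rewrite msizeD msize_munit addn1. Qed.

Lemma msize0 : msize (0 : mindex n) = 0%N.
Proof. by rewrite /msize big1// => i _; rewrite ffunE. Qed.

Lemma msize_eq0 a : (msize a == 0%N) = (a == 0).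
Proof.
apply/eqP/eqP => [a0|->]; last exact: msize0.
apply/ffunP => i; rewrite ffunE; apply/eqP; rewrite -leqn0 -a0 /msize.
by rewrite (bigD1 i)//= leq_addr.
Qed.

(** The variables of an iterated partial derivative, innermost first. *)
Definition mvars a : seq 'I_n :=
  foldr (fun i s => s ++ nseq (a i) i) [::] (enum 'I_n).

Lemma count_mvars a i : count_mem i (mvars a) = a i.
Proof.
rewrite /mvars; have -> : a i = (\sum_(j <- enum 'I_n) a j * (j == i))%N.
  rewrite big_enum/= (bigD1 i)//= eqxx muln1 big1 ?addn0// => j /negbTE ->.
  by rewrite muln0.
elim: (enum 'I_n) => [|j s IH] /=; first by rewrite big_nil.
by rewrite count_cat big_cons IH addnC count_nseq/= mulnC.
Qed.

Lemma size_mvars a : size (mvars a) = msize a.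
Proof.
rewrite /mvars /msize -big_enum/=.
elim: (enum 'I_n) => [|j s IH] /=; first by rewrite big_nil.
by rewrite size_cat big_cons IH size_nseq addnC.
Qed.

Lemma perm_mvarsS a i : perm_eq (rcons (mvars a) i) (mvars (a + munit i)).
Proof.
rewrite /perm_eq; apply/allP => j _ /=.
rewrite -cats1 count_cat !count_mvars !ffunE/= addn0.
by rewrite [i == j]eq_sym.
Qed.

Lemma sum_mvars a : \sum_(i <- mvars a) munit i = a.
Proof.
apply/ffunP => j; rewrite -[RHS]count_mvars.
elim: (mvars a) => [|i s IH]; first by rewrite big_nil ffunE.
by rewrite big_cons/= !ffunE IH eq_sym.
Qed.

End multi_index_theory.

Lemma leq_extW (l m : nat) k : (l <= m)%N -> leq_ext m k -> leq_ext l k.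
Proof. by case: k => //= k; exact: leq_trans. Qed.

Section iter_partial_theory.
Context {R : realType} {E : hausdorffTvsType R} {n : nat}.

Definition mdirs (a : mindex n) : seq 'rV[R]_n :=
  [seq delta_mx 0 i | i <- mvars a].

Lemma iter_dirD_cat (g : 'rV[R]_n -> E) ys zs :
  iter_dirD g (ys ++ zs) = iter_dirD (iter_dirD g ys) zs.
Proof. exact: foldl_cat. Qed.

Lemma iter_partialE (a : mindex n) (g : 'rV[R]_n -> E) :
  iter_partial a g = iter_dirD g (mdirs a).
Proof.
rewrite /iter_partial /mdirs /mvars; elim: (enum 'I_n) => [//|i s IH] /=.
rewrite map_cat iter_dirD_cat -IH map_nseq; move: (foldr _ _ _) => h.
by elim: (a i) h => [//|m IHm] h; rewrite iterSr IHm.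
Qed.

Lemma rows_onto (ys : seq 'rV[R]_n) :
  exists Y : 'M[R]_(size ys, n), rows Y = ys.
Proof.
exists (\matrix_(i, j) (nth 0 ys i) 0 j).
apply: (@eq_from_nth _ 0); rewrite /rows size_map size_enum_ord// => i il.
rewrite (nth_map (Ordinal il)) ?size_enum_ord//.
by apply/rowP => j; rewrite !mxE nth_enum_ord.
Qed.

Lemma smooth_iter_dirD (O : set 'rV[R]_n) m (g : 'rV[R]_n -> E) ys :
  smooth_on O (size ys + m) g -> smooth_on O m (iter_dirD g ys).
Proof.
by elim: ys g => [//|y ys IH] g gm /=; apply: IH; exact: smooth_dirD.
Qed.

End iter_partial_theory.

(** * Functions on U *)

Lemma continuous_pairl (T T' : topologicalType) (y : T') :
  continuous (fun x : T => (x, y)).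
Proof. by move=> x; apply: cvg_pair; [exact: cvg_id|exact: cvg_cst]. Qed.

Section functions_on_subset.
Context {R : realType} {E : hausdorffTvsType R} {n : nat} (U : set 'rV[R]_n).

Lemma continuous_ext0 (f : U -> E) : continuous f ->
  {within U, continuous (ext0 f)}.
Proof. by move=> ?; exact/subspace_valL_continuousP'. Qed.

Lemma within_cvg (g : 'rV[R]_n -> E) x : {within U, continuous g} -> U x ->
  g y @[y --> within U (nbhs x)] --> g x.
Proof. by move=> /subspace_continuousP gc Ux; exact: gc. Qed.

Lemma interior_cvg (g : 'rV[R]_n -> E) x : {within U, continuous g} -> U° x ->
  g @ x --> g x.
Proof.
move=> gc Ux; rewrite -(within_interior Ux).
by apply: within_cvg => //; exact: interior_subset.
Qed.

Lemma near_interior x : U° x -> \forall y \near x, U° y.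
Proof.
by move=> Ux; apply: open_nbhs_nbhs; split => //; exact: open_interior.
Qed.

Lemma ext0_in (f : U -> E) x (Ux : U x) : ext0 f x = f (SigSub (mem_set Ux)).
Proof. by rewrite -ext0E. Qed.

Lemma dense_interior_eq (g h : 'rV[R]_n -> E) : dense_interior U ->
  {within U, continuous g} -> {within U, continuous h} ->
  {in (U° : set 'rV[R]_n), g =1 h} -> {in U, g =1 h}.
Proof.
move=> diU gc hc gh x /set_mem Ux; apply/eqP; rewrite -subr_eq0; apply/eqP.
apply: seminorm_eq0 => q e qs e0; have e20 : 0 < e / 2 by rewrite divr_gt0.
have : \forall y \near within U (nbhs x),
    q (g y - g x) < e / 2 /\ q (h y - h x) < e / 2.
  by near=> y; split; near: y; apply: seminorm_cvg => //; exact: within_cvg.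
rewrite near_withinE => /(diU _ Ux)[y [Uy]] /(_ (interior_subset Uy))[gy hy].
rewrite (le_trans (seminorm_tri qs (g y) _ _))// [e]splitr.
by rewrite lerD ?(seminormBC qs (g x)) 1?ltW// gh ?inE.
Unshelve. all: by end_near. Qed.

End functions_on_subset.

(** * Derivative families and C^k-functions *)

Section derivative_family.
Context {R : realType} {E : hausdorffTvsType R} {n : nat}.
Context (k : option nat) (U : set 'rV[R]_n).

(** The common description of C^k-functions and Whitney k-jets. Stating the
   derivative in all directions v saves a separate proof of linearity in v
   whenever a family is restricted to a segment. *)
Definition derivative_family (G : mindex n -> 'rV[R]_n -> E) : Prop :=
  (forall a, leq_ext (msize a) k -> {within U, continuous (G a)}) /\
  (forall a v x, leq_ext (msize a).+1 k -> U° x ->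
    is_dirD (G a) v x (\sum_i v 0 i *: G (a + munit i) x)).

Section Ck_family.
Variables (f : U -> E) (fk : is_Ck k f).

Lemma Ck_extension ys : leq_ext (size ys) k ->
  exists2 h : U -> E, continuous h &
    forall x : U, U° (val x) -> h x = iter_dirD (ext0 f) ys (val x).
Proof.
have [fc fl] := fk; case: ys => [_|y ys yk].
  by exists f => // x Ux; rewrite /= ext0E.
have [_ _ [h hc hE]] := fl (size (y :: ys)) isT yk.
have [Y YE] := rows_onto (y :: ys).
exists (fun x => h (x, Y)); last by move=> x Ux; rewrite hE// /dl /= YE.
move=> x; apply: (@continuous_comp _ _ _ (fun z : U => (z, Y)) h); last exact: hc.
exact: continuous_pairl.
Qed.

Lemma Ck_smooth m : leq_ext m k -> smooth_on U° m (ext0 f).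
Proof.
move=> mk ys ysm; have ysk := leq_extW ysm mk; split.
  case: ys ysm ysk => [//|y ys] _ yk; have [_ fl] := fk.
  have [fd _ _] := fl (size (y :: ys)) isT yk.
  by have [Y YE] := rows_onto (y :: ys); have := fd Y; rewrite YE.
move=> x Ux; have [h hc hE] := Ck_extension ysk.
have hE' y : U° y -> iter_dirD (ext0 f) ys y = ext0 h y.
  move=> Uy; rewrite (ext0_in _ (interior_subset Uy)) hE//.
rewrite hE'//; apply: cvg_trans (interior_cvg (continuous_ext0 hc) Ux).
apply: (@near_eq_cvg _ _ (nbhs x)); near=> y; rewrite hE'//; near: y; exact: near_interior.
Unshelve. all: by end_near. Qed.

Lemma partialP a : leq_ext (msize a) k -> continuous (partial a f) /\
  forall x : U, U° (val x) -> partial a f x = iter_dirD (ext0 f) (mdirs a) (val x).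
Proof.
move=> ak; have [h hc hE] : exists2 h : U -> E, continuous h & forall x : U,
    U° (val x) -> h x = iter_dirD (ext0 f) (mdirs a) (val x).
  by apply: Ck_extension; rewrite size_map size_mvars.
rewrite -iter_partialE in hE *.
by rewrite /partial; case: xgetP => [g _ []//|/(_ h) []].
Qed.

Lemma Ck_derivative_family : derivative_family (fun a => ext0 (partial a f)).
Proof.
split=> [a ak|a v x ak Ux]; first exact/continuous_ext0/(partialP ak).1.
have GE b y : leq_ext (msize b) k -> U° y ->
    ext0 (partial b f) y = iter_dirD (ext0 f) (mdirs b) y.
  by move=> bk Uy; rewrite (ext0_in _ (interior_subset Uy)) (partialP bk).2.
have nU := near_interior Ux.
have aS : smooth_on U° (msize a).+1 (ext0 f) by exact: Ck_smooth.
apply: (@is_dirD_near _ _ _ (iter_dirD (ext0 f) (mdirs a))).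
  by apply: filterS nU => y Uy; rewrite GE//; exact: leq_extW ak.
have -> : \sum_i v 0 i *: ext0 (partial (a + munit i) f) x =
    \sum_i v 0 i *: dirD (delta_mx 0 i) (iter_dirD (ext0 f) (mdirs a)) x.
  apply: eq_bigr => i _; congr (_ *: _); rewrite GE ?msizeS//.
  have p : perm_eq (mdirs (a + munit i)) (rcons (mdirs a) (delta_mx 0 i : 'rV[R]_n)).
    have := perm_map (fun i => delta_mx 0 i : 'rV[R]_n) (perm_mvarsS a i).
    by rewrite map_rcons perm_sym.
  rewrite (iter_dirD_perm (@open_interior _ U) p) ?inE//.
    by rewrite -cats1 iter_dirD_cat.
  by rewrite size_map size_mvars msizeS.
apply: (is_dirD_sum (@open_interior _ U) (m := 0)) => //.
by apply: smooth_iter_dirD; rewrite size_map size_mvars addn1.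
Qed.

End Ck_family.

Section family_Ck.
Variables (G : mindex n -> 'rV[R]_n -> E) (GP : derivative_family G).

(** The value at x and y_1, .., y_l of d^(l) G_a that the multilinearity of
   d^(l) and the relations D_i G_a = G_(a + e_i) predict; it makes sense on the
   whole of U, which yields the continuous extension of d^(l) G_a. *)
Fixpoint family_dl a (ys : seq 'rV[R]_n) (x : 'rV[R]_n) : E :=
  if ys is y :: ys' then \sum_i y 0 i *: family_dl (a + munit i) ys' x
  else G a x.

Lemma family_dl_delta a s x :
  family_dl a [seq delta_mx 0 i | i <- s] x = G (a + \sum_(i <- s) munit i) x.
Proof.
elim: s a => [|i s IH] a /=; first by rewrite big_nil addr0.
rewrite (bigD1 i)//= big1 => [|j ji].
  by rewrite mxE !eqxx scale1r addr0 IH big_cons addrA.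
by rewrite mxE (negbTE ji) andbF scale0r.
Qed.

Lemma iter_dirD_sum (O : set 'rV[R]_n) (I : Type) (s : seq I) (c : I -> R)
    (F : I -> 'rV[R]_n -> E) h ys : open O ->
  {in O, h =1 (fun x => \sum_(i <- s) c i *: F i x)} ->
  (forall i, iter_derivable O (F i) ys) ->
  iter_derivable O h ys /\
  {in O, iter_dirD h ys =1 (fun x => \sum_(i <- s) c i *: iter_dirD (F i) ys x)}.
Proof.
move=> oO hE Fd; elim: s h hE => [|i s IH] h hE.
  have [|hd hE'] := @iter_dirD0 _ _ _ _ oO h ys.
    by move=> x Ox; rewrite hE// big_nil.
  by split => // x Ox; rewrite hE'// big_nil.
have [//|sd sE] := IH (fun x => \sum_(i <- s) c i *: F i x).
have [|hd hE'] := iter_dirD_lincomb oO (c := c i) (h := h) _ (Fd i) sd.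
  by move=> x Ox; rewrite hE// big_cons.
by split => // x Ox; rewrite hE'// big_cons sE.
Qed.

Lemma iter_dirD_family a ys h : leq_ext (msize a + size ys) k ->
  {in (U° : set 'rV[R]_n), h =1 G a} ->
  iter_derivable U° h ys /\ {in (U° : set 'rV[R]_n), iter_dirD h ys =1 family_dl a ys}.
Proof.
elim: ys a h => [//|y ys IH] a h ak ha /=.
have hd x : U° x -> is_dirD h y x (\sum_i y 0 i *: G (a + munit i) x).
  move=> Ux; apply: (@is_dirD_near _ _ _ (G a)).
    by apply: filterS (near_interior Ux) => z Uz; rewrite ha ?inE.
  by apply: GP.2 => //; apply: leq_extW ak; rewrite -addn1 leq_add2l.
have IH' i : iter_derivable U° (G (a + munit i)) ys /\
    {in (U° : set 'rV[R]_n), iter_dirD (G (a + munit i)) ys =1 family_dl (a + munit i) ys}.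
  by apply: IH => //; rewrite msizeS addSnnS.
have [|//|dd dE] := @iter_dirD_sum U° _ (index_enum 'I_n) (fun i => y 0 i)
  (fun i => G (a + munit i)) (dirD y h) ys (@open_interior _ U).
- by move=> x /set_mem Ux; exact: dirDE (hd x Ux).
- by move=> i; have [] := IH' i.
split; first by split => // x Ux; exists (\sum_i y 0 i *: G (a + munit i) x); exact: hd.
by move=> x Ux; rewrite dE//; apply: eq_bigr => i _; rewrite (IH' i).2.
Qed.

Lemma family_dl_cvg (T : Type) (F : set_system T) {FF : Filter F} l
    (xf : T -> 'rV[R]_n) (Yf : T -> 'M[R]_(l, n)) (x : 'rV[R]_n) (Y : 'M[R]_(l, n))
    (s : seq 'I_l) a :
  (forall b, leq_ext (msize b) k -> G b (xf t) @[t --> F] --> G b x) ->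
  Yf @ F --> Y -> leq_ext (msize a + size s) k ->
  family_dl a [seq row i (Yf t) | i <- s] (xf t) @[t --> F] -->
  family_dl a [seq row i Y | i <- s] x.
Proof.
move=> Gx FY; elim: s a => [|i s IH] a /= ak.
  by apply: Gx; rewrite addn0 in ak.
apply: tvs_cvg_sum => j; apply: tvs_cvgZ.
  under eq_fun do rewrite mxE; rewrite mxE.
  exact: (cvg_comp _ _ FY (@coord_continuous _ _ _ i j Y)).
by apply: IH; rewrite msizeS addSnnS.
Qed.

Lemma family_is_Ck (f : U -> E) : {in U, G 0 =1 ext0 f} -> is_Ck k f.
Proof.
move=> f0; have [Gc _] := GP.
have G0c : {within U, continuous (G 0)} by apply: Gc; rewrite msize0; case: k.
have f0' : {in (U° : set 'rV[R]_n), ext0 f =1 G 0}.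
  by move=> x /set_mem /interior_subset Ux; rewrite f0// inE.
split.
  apply/subspace_valL_continuousP'; apply: subspace_eq_continuous G0c => x Ux.
  exact: f0.
move=> l l0 lk.
have sz (Y : 'M[R]_(l, n)) : leq_ext (msize (0 : mindex n) + size (rows Y)) k.
  by rewrite msize0 /rows size_map size_enum_ord.
have fE x Y : U° x -> dl (l := l) (ext0 f) (x, Y) = family_dl 0 (rows Y) x.
  by move=> Ux; rewrite /dl (iter_dirD_family (sz Y) f0').2 ?inE.
split.
- by move=> Y; have [] := iter_dirD_family (sz Y) f0'.
- apply/subspace_continuousP => -[x Y] [/= Ux _].
  rewrite /from_subspace fE//.
  have xO : \forall p \near (x, Y), U° p.1.
    exact: (@cvg_fst _ _ (nbhs x) (nbhs Y) _ _ (near_interior Ux)).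
  apply: (@cvg_trans _ (family_dl 0 (rows p.2) p.1 @[p --> nbhs (x, Y)])).
    apply: cvg_trans (cvg_app _ (@cvg_within _ _ _ _)) _.
    apply: (@near_eq_cvg _ _ (nbhs (x, Y))).
    by apply: filterS xO => -[z Z] /= Uz; rewrite -fE.
  apply: family_dl_cvg; last by have := sz Y; rewrite /rows size_map.
  + move=> b bk; apply: (@cvg_comp _ _ _ fst (G b) _ (nbhs x)); first exact: cvg_fst.
    exact: (interior_cvg (Gc b bk) Ux).
  + exact: cvg_snd.
- exists (fun p => family_dl 0 (rows p.2) (val p.1)); last first.
    by move=> x Y Ux; rewrite fE.
  move=> [x Y]; apply: family_dl_cvg; last by have := sz Y; rewrite /rows size_map.
  + move=> b bk; have /subspace_sigL_continuousP Gb := (GP.1 b bk).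
    exact: (@cvg_comp _ _ _ fst (sigL U (G b)) _ (nbhs x) _ cvg_fst (Gb x)).
  + exact: cvg_snd.
Qed.

End family_Ck.
End derivative_family.

(** Both functions are continuous on U and agree on the dense subset U°. *)
Lemma family_partial {R : realType} {E : hausdorffTvsType R} {n : nat}
    (k : option nat) (U : set 'rV[R]_n) (G : mindex n -> 'rV[R]_n -> E)
    (f : U -> E) (a : mindex n) :
  dense_interior U -> derivative_family k U G -> {in U, G 0 =1 ext0 f} ->
  leq_ext (msize a) k -> {in U, ext0 (partial a f) =1 G a}.
Proof.
move=> diU GP f0 ak; have fk := family_is_Ck GP f0.
have [pc pE] := partialP fk ak.
apply: dense_interior_eq => //; first exact: continuous_ext0.
  exact: GP.1.
move=> x /set_mem Ux; rewrite (ext0_in _ (interior_subset Ux)) pE//=.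
have f0' : {in (U° : set 'rV[R]_n), ext0 f =1 G 0}.
  by move=> y /set_mem /interior_subset Uy; rewrite f0// inE.
have a0 : leq_ext (msize (0 : mindex n) + size (mdirs a : seq 'rV[R]_n)) k.
  by rewrite msize0 size_map size_mvars.
rewrite (iter_dirD_family GP a0 f0').2 ?inE//.
by rewrite /mdirs family_dl_delta add0r sum_mvars.
Qed.

Lemma partial0 {R : realType} {E : hausdorffTvsType R} {n : nat}
    (k : option nat) (U : set 'rV[R]_n) (f : U -> E) :
  dense_interior U -> is_Ck k f -> partial 0 f = f.
Proof.
move=> diU fk; have [|pc pE] := partialP fk (a := 0).
  by rewrite msize0; case: k fk.
apply/funext => x; rewrite -[LHS]ext0E -[RHS]ext0E.
apply: (dense_interior_eq diU); [exact: continuous_ext0| |move=> y /set_mem Uy|].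
- by apply: continuous_ext0; have [] := fk.
- rewrite (ext0_in _ (interior_subset Uy)) pE//= -iter_partialE /iter_partial.
  elim: (enum 'I_n) => //= i s; rewrite ffunE/= => ->.
  by rewrite /=.
- exact: valP.
Qed.

(** * Taylor remainders of a derivative family *)

Section monomials.
Context {R : realType} {n : nat}.
Implicit Types (x : 'rV[R]_n) (b : mindex n).

Lemma mpowS x b i : mpow x (b + munit i) = mpow x b * x 0 i.
Proof.
rewrite /mpow (bigD1 i)//= [in RHS](bigD1 i)//= mindexDE munitE eqxx addn1 exprSr.
rewrite mulrAC; congr (_ * _ * _); apply: eq_bigr => j ji.
by rewrite mindexDE munitE (negbTE ji) addn0.
Qed.

Lemma mfactS b i : mfact (b + munit i) = ((b i).+1 * mfact b)%N.
Proof.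
rewrite /mfact (bigD1 i)//= [in RHS](bigD1 i)//= mindexDE munitE eqxx addn1 factS mulnA.
congr (_ * _)%N; apply: eq_bigr => j ji.
by rewrite mindexDE munitE (negbTE ji) addn0.
Qed.

Lemma mpowZ c x b : mpow (c *: x) b = c ^+ msize b * mpow x b.
Proof.
rewrite /mpow /msize -prodrXr -big_split/=; apply: eq_bigr => i _.
by rewrite mxE exprMn.
Qed.

Lemma mpowx0 x : mpow x 0 = 1.
Proof. by rewrite /mpow big1// => i _; rewrite ffunE expr0. Qed.

Lemma mfact0 : mfact (0 : mindex n) = 1%N.
Proof. by rewrite /mfact big1// => i _; rewrite ffunE. Qed.

Lemma mfact_neq0 b : (mfact b)%:R != 0 :> R.
Proof.
rewrite pnatr_eq0 -lt0n /mfact; apply: prodn_gt0 => i; exact: fact_gt0.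
Qed.

Lemma mpow0x b : mpow (0 : 'rV[R]_n) b = (b == 0)%:R.
Proof.
have [->|b0] := eqVneq b 0; first by rewrite mpowx0.
have [i bi] : exists i, b i != 0%N.
  apply/existsP; rewrite -negb_forall; apply: contra b0 => /forallP b0.
  by apply/eqP/ffunP => i; rewrite ffunE; exact/eqP/b0.
by rewrite /mpow (bigD1 i)//= mxE expr0n (negbTE bi) mul0r.
Qed.

Lemma sum_mindices0 (V : nmodType) (F : mindex n -> V) :
  \sum_(b <- mindices n 0) F b = F 0.
Proof.
rewrite (perm_big [:: 0]) ?big_seq1//; apply: uniq_perm => //.
  exact: mindices_uniq.
by move=> b; rewrite mem_mindices inE leqn0 msize_eq0.
Qed.

Lemma sum_mindicesS (V : nmodType) m i (F : mindex n -> V) :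
  \sum_(b <- mindices n m.+1 | (0 < b i)%N) F b =
  \sum_(b <- mindices n m) F (b + munit i).
Proof.
rewrite -big_filter -(big_map (fun b => b + munit i) xpredT F).
apply/perm_big/uniq_perm => [||b].
- by rewrite filter_uniq ?mindices_uniq.
- rewrite map_inj_uniq ?mindices_uniq// => b b' /ffunP bb'.
  by apply/ffunP => j; have := bb' j; rewrite !mindexDE => /addIn.
- rewrite mem_filter mem_mindices; apply/andP/mapP => [[bi bm]|[b' + ->]].
    have bE : b = [ffun j => (b j - (j == i))%N] + munit i.
      apply/ffunP => j; rewrite mindexDE munitE ffunE subnK//.
      by case: eqVneq => // ->.
    exists [ffun j => (b j - (j == i))%N] => //.
    by rewrite mem_mindices -ltnS -(msizeS _ i) -bE.
  by rewrite mem_mindices mindexDE munitE eqxx addn1 msizeS.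
Qed.

(** Both sides are the derivative with respect to c of the Taylor polynomial of
   order m + 1 at c x: computed on homogeneous parts on the left, with Euler's
   identity on the right. The term of b = 0 vanishes on the left. *)
Lemma taylor_polynomial_derivative (V : lmodType R) m (c : R) x (C : mindex n -> V) :
  \sum_(b <- mindices n m.+1)
    ((msize b)%:R * c ^+ (msize b).-1 * (mpow x b / (mfact b)%:R)) *: C b =
  \sum_i x 0 i *: \sum_(b <- mindices n m)
    (mpow (c *: x) b / (mfact b)%:R) *: C (b + munit i).
Proof.
transitivity (\sum_(b <- mindices n m.+1) \sum_i
    ((b i)%:R * c ^+ (msize b).-1 * (mpow x b / (mfact b)%:R)) *: C b).
  apply: eq_bigr => b _; rewrite -scaler_suml; congr (_ *: _).
  by rewrite -!mulr_suml -natr_sum.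
rewrite exchange_big/=; apply: eq_bigr => i _.
rewrite scaler_sumr (bigID (fun b : mindex n => (0 < b i)%N))/= addrC big1 ?add0r.
  rewrite sum_mindicesS; apply: eq_bigr => b _.
  rewrite scalerA; congr (_ *: _).
  rewrite msizeS/= mpowS mfactS mpowZ mindexDE munitE eqxx addn1 natrM.
  have bf := mfact_neq0 b; have bi : (b i).+1%:R != 0 :> R by rewrite pnatr_eq0.
  move: ((b i).+1%:R) bi ((mfact b)%:R) bf => u u0 v v0.
  by field; rewrite u0 v0.
by move=> b; rewrite -leqNgt leqn0 => /eqP ->; rewrite !mul0r scale0r.
Qed.

End monomials.

Section taylor.
Context {R : realType} {E : hausdorffTvsType R} {n : nat}.
Context (k : option nat) (U : set 'rV[R]_n).
Hypotheses (lcU : locally_convex_subset U) (diU : dense_interior U).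
Variables (G : mindex n -> 'rV[R]_n -> E) (GP : derivative_family k U G).

(** A small ball of U is convex, and moving its points slightly towards an
   interior point p brings them into the interior of U: if a ball around p is
   contained in U, then so is its image under y |-> t y + (1 - t) x. *)
Lemma small_balls_convex x0 : U x0 -> exists2 r0, 0 < r0 & forall r, 0 < r -> r <= r0 ->
  let V := U `&` [set x | `|x - x0| < r] in
  (forall x y t, V x -> V y -> 0 <= t <= 1 -> V (t *: x + (1 - t) *: y)) /\
  exists2 p, V p & forall x t, V x -> 0 < t <= 1 -> U° (t *: p + (1 - t) *: x).
Proof.
move=> Ux0; have [C [CU /convex_setP cC]] := lcU Ux0.
move=> /nbhs_norm_lt[r0 r00 r0C]; exists r0 => // r r_gt0 rr0 V.
have cV x y t : V x -> V y -> 0 <= t <= 1 -> V (t *: x + (1 - t) *: y).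
  move=> [Ux xr] [Uy yr] /[dup] t01 /andP[t0 t1]; split.
    apply/CU/cC => //; apply: r0C => //; exact: lt_le_trans rr0.
  rewrite /=; have -> : t *: x + (1 - t) *: y - x0 = t *: (x - x0) + (1 - t) *: (y - x0).
    by rewrite !scalerBr addrACA -opprD -scalerDl subrKC scale1r.
  rewrite /= (le_lt_trans (ler_normD _ _))// !normrZ ger0_norm//.
  rewrite ger0_norm ?subr_ge0//.
  have [->|tn0] := eqVneq t 0; first by rewrite mul0r add0r subr0 mul1r.
  rewrite -[ltRHS](subrKC (t * r)) ltr_leD//; first by rewrite ltr_pM2l// lt0r tn0.
  by rewrite -[X in _ <= X - _]mul1r -mulrBl ler_wpM2l ?subr_ge0// ltW.
split=> //.
have [p [Up pr]] : U° `&` [set x | `|x - x0| < r] !=set0.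
  apply: (diU Ux0); apply/nbhs_ballP; exists r => //= y.
  by rewrite -ball_normE /= distrC.
exists p; first by split => //; exact: interior_subset.
move=> x t Vx /andP[t0 t1].
have : nbhs p (U° `&` [set x | `|x - x0| < r]).
  apply: filterI; first exact: near_interior.
  apply/nbhs_ballP; exists (r - `|p - x0|) => /=; first by rewrite subr_gt0.
  move=> y; rewrite -ball_normE /= ltrBrDr distrC; apply: le_lt_trans.
  by rewrite -[y - x0](subrKA p) ler_normD.
move=> /nbhs_norm_lt[d d0 dV]; apply/nbhs_ballP.
exists (t * d) => /=; first exact: mulr_gt0.
move=> z; rewrite -ball_normE /= distrC => zx.
pose p' := p + t^-1 *: (z - (t *: p + (1 - t) *: x)).
have Vp' : V p'.
  have [|/interior_subset ? ?] := dV p'; last by split.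
  by rewrite /p' addrC addKr normrZ normfV gtr0_norm// mulrC ltr_pdivrMr// mulrC.
have [] := cV p' x t Vp' Vx; first by rewrite (ltW t0).
by rewrite /p' scalerDr scalerA divff ?gt_eqF// scale1r addrAC subrKC.
Qed.

Lemma coord_le_norm (v : 'rV[R]_n) i : `|v 0 i| <= `|v|.
Proof. by rewrite [leRHS]mx_normrE; exact: (le_bigmax _ _ (0, i)). Qed.

Lemma seminorm_lincomb_le (q : E -> R) (v : 'rV[R]_n) (F : 'I_n -> E) M :
  cont_seminorm q -> (forall i, q (F i) <= M) ->
  q (\sum_i v 0 i *: F i) <= n%:R * `|v| * M.
Proof.
move=> qs FM; rewrite (le_trans (seminorm_sum qs _ _ _))//.
rewrite (@le_trans _ _ (\sum_(i < n) `|v| * M))//.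
  apply: ler_sum => i _; rewrite (seminormZ qs) ler_pM ?(seminorm_ge0 qs)//.
  exact: coord_le_norm.
by rewrite sumr_const card_ord -mulrA mulr_natl.
Qed.

(** Strict differentiability, also at boundary points: the mean value
   inequality for nearby points x, y is transported to interior points by
   moving x and y towards an interior point p by the same ratio t, and t tends
   to 0. *)
Lemma strict_derivative a x0 q e : leq_ext (msize a).+1 k -> U x0 ->
  cont_seminorm q -> 0 < e ->
  exists2 r, 0 < r & forall x y, U x -> U y -> `|x - x0| < r -> `|y - x0| < r ->
    q (G a x - G a y - \sum_i (x - y) 0 i *: G (a + munit i) x0) <= e * `|x - y|.
Proof.
move=> ak Ux0 qs e0; pose d := e / n.+1%:R; have d0 : 0 < d by rewrite divr_gt0.
have ndE : n%:R * d <= e.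
  rewrite /d mulrCA ger_pMr// ler_pdivrMr// mul1r ler_nat; exact: leqnSn.
have : \forall y \near within U (nbhs x0), forall i : 'I_n,
    q (G (a + munit i) y - G (a + munit i) x0) < d.
  apply: filter_forall => i; apply: seminorm_cvg => //.
  by apply: within_cvg => //; apply: GP.1; rewrite msizeS.
rewrite near_withinE => /nbhs_norm_lt[r1 r10 r1P].
have [r0 r00 r0P] := small_balls_convex Ux0.
pose r := Num.min r0 r1; have r_gt0 : 0 < r by rewrite lt_min r00.
have rr0 : r <= r0 by rewrite ge_min lexx.
have [cV [p Vp pV]] := r0P r r_gt0 rr0; set V := U `&` _ in cV Vp pV.
exists r => // x y Ux Uy xr yr.
pose D := fun (v z : 'rV[R]_n) => \sum_i v 0 i *: G (a + munit i) z.
have DZ c v z : D (c *: v) z = c *: D v z.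
  by rewrite /D scaler_sumr; apply: eq_bigr => i _; rewrite mxE scalerA.
have Dle v z : V z -> q (D v z - D v x0) <= e * `|v|.
  move=> [Uz zr]; rewrite /D -sumrB; under eq_bigr do rewrite -scalerBr.
  apply: (le_trans (seminorm_lincomb_le _ qs (M := d) _)) => [i|].
    by rewrite ltW// r1P// (lt_le_trans zr)// ge_min lexx orbT.
  by rewrite mulrAC ler_wpM2r.
(* For 0 < t <= 1 these points and the segment between them lie in U°. *)
pose xt t := t *: p + (1 - t) *: x; pose yt t := t *: p + (1 - t) *: y.
have xytE t : xt t - yt t = (1 - t) *: (x - y).
  by rewrite /xt /yt opprD addrACA subrr add0r scalerBr.
have step t : 0 < t <= 1 ->
    q (G a (xt t) - G a (yt t) - (1 - t) *: D (x - y) x0) <= e * `|x - y|.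
  move=> t01; rewrite -DZ -xytE -[in X in G a X - _](subrKC (yt t) (xt t)).
  have tle1 : `|1 - t| <= 1.
    by case/andP: t01 => t0 t1; rewrite ger0_norm ?subr_ge0// lerBlDl lerDr ltW.
  apply: (@le_trans _ _ (e * `|xt t - yt t|)); last first.
    by rewrite xytE normrZ ler_wpM2l ?(ltW e0)// ler_piMl.
  have seg s : 0 <= s <= 1 ->
      yt t + s *: (xt t - yt t) = t *: p + (1 - t) *: (s *: x + (1 - s) *: y).
    move=> _; rewrite xytE /yt -addrA; congr (_ + _).
    rewrite scalerA mulrC -scalerA -scalerDr; congr (_ *: _).
    by rewrite scalerBr scalerBl scale1r addrCA.
  have Vs s : 0 <= s <= 1 -> V (s *: x + (1 - s) *: y) by move=> ?; exact: cV.
  apply: (@dirD_mean_value _ _ _ q (G a) (D (xt t - yt t))) => // s s01.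
    by rewrite seg//; apply: GP.2 => //; apply: pV => //; exact: Vs.
  apply: Dle; rewrite seg//; apply: cV => //; first exact: Vs.
  by case/andP: t01 => /ltW -> ->.
have cvgt z : U z -> V z -> forall h, 0 < h -> \forall t \near (0 : R)^'+,
    q (G a (t *: p + (1 - t) *: z) - G a z) < h.
  move=> Uz Vz h h0.
  have near_z : \forall z' \near within U (nbhs z), q (G a z' - G a z) < h.
    apply: seminorm_cvg => //; apply: within_cvg => //; apply: GP.1.
    exact: leq_extW ak.
  have ztz : t *: p + (1 - t) *: z @[t --> (0 : R)] --> z.
    have : t *: p + (1 - t) *: z @[t --> (0 : R)] --> 0 *: p + (1 - 0) *: z.
      apply: cvgD; first by apply: cvgZr_tmp; exact: cvg_id.
      by apply: cvgZr_tmp; apply: cvgB; [exact: cvg_cst|exact: cvg_id].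
    by rewrite scale0r add0r subr0 scale1r.
  rewrite near_withinE in near_z; near=> t.
  have t01 : 0 < t <= 1.
    apply/andP; split; near: t; first exact: nbhs_right_gt.
    exact: nbhs_right_le.
  suff : U (t *: p + (1 - t) *: z) -> q (G a (t *: p + (1 - t) *: z) - G a z) < h.
    by apply; apply: interior_subset; exact: pV.
  near: t; have ztz' : t *: p + (1 - t) *: z @[t --> (0 : R)^'+] --> z.
    exact: cvg_within_filter.
  exact: (ztz' _ near_z).
apply/ler_addgt0Pr => h h0; have h30 : 0 < h / 3%:R by rewrite divr_gt0.
pose Q := q (D (x - y) x0).
have Q1 : 0 < Q + 1 by rewrite ltr_wpDl// (seminorm_ge0 qs).
have hQ : 0 < h / 3%:R / (Q + 1) by exact: divr_gt0.
have [t [t01 xh yh th]] : exists t, [/\ 0 < t <= 1, q (G a (xt t) - G a x) < h / 3%:R,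
    q (G a (yt t) - G a y) < h / 3%:R & t * Q < h / 3%:R].
  apply: (@filter_ex _ ((0 : R)^'+)); near=> t; split.
  - apply/andP; split; near: t; first exact: nbhs_right_gt.
    exact: nbhs_right_le.
  - by near: t; apply: cvgt.
  - by near: t; apply: cvgt.
  - have tQ : t < h / 3%:R / (Q + 1) by [near: t; exact: nbhs_right_lt].
    have t0 : 0 < t by [near: t; exact: nbhs_right_gt].
    apply: (@le_lt_trans _ _ (t * (Q + 1))).
      by apply: ler_wpM2l; [exact: ltW|rewrite lerDl].
    by rewrite -ltr_pdivlMr.
have h1 : q (G a x - G a y - (G a (xt t) - G a (yt t))) <= h / 3%:R + h / 3%:R.
  rewrite opprD addrACA -opprD (le_trans (seminormB qs _ _))//.
  by apply: lerD; rewrite (seminormBC qs) ltW.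
have h2 : q ((1 - t) *: D (x - y) x0 - D (x - y) x0) <= h / 3%:R.
  rewrite scalerBl scale1r addrAC subrr add0r seminormN// seminormZ// ger0_norm.
    exact: ltW.
  by case/andP: t01 => /ltW.
rewrite (le_trans (seminorm_tri qs (G a (xt t) - G a (yt t)) _ _))//.
have := seminorm_tri qs ((1 - t) *: D (x - y) x0) (G a (xt t) - G a (yt t))
  (D (x - y) x0).
move: (step t t01) h1 h2; rewrite -/(D _ _).
move: (q _) (q _) (q _) (q _) (e * _) => *; lra.
Unshelve. all: by end_near. Qed.

End taylor.

Section taylor_estimate.
Context {R : realType} {E : hausdorffTvsType R} {n : nat}.
Context (k : option nat) (U : set 'rV[R]_n).
Hypotheses (lcU : locally_convex_subset U) (diU : dense_interior U).
Variables (G : mindex n -> 'rV[R]_n -> E) (GP : derivative_family k U G).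
Variables (q : E -> R) (qs : cont_seminorm q).

Definition taylor_remainder m (a : mindex n) (y x : 'rV[R]_n) : E :=
  G a x - \sum_(b <- mindices n m)
    (mpow (x - y) b / (mfact b)%:R) *: G (a + b) y.

Lemma taylor_remainderyy m a y : taylor_remainder m a y y = 0.
Proof.
rewrite /taylor_remainder subrr (bigD1_seq 0) ?mindices_uniq ?mem_mindices ?msize0//=.
rewrite mpow0x eqxx mfact0 divr1 scale1r addr0 big1 ?addr0 ?subrr// => b b0.
by rewrite mpow0x (negbTE b0) mul0r scale0r.
Qed.

Lemma near_exprn (c : R) j (e : R) : 0 < e -> \forall s \near c,
  `|s ^+ j - c ^+ j - (s - c) * (j%:R * c ^+ j.-1)| <= e * `|s - c|.
Proof.
move=> e0; pose g s := \sum_(i < j) s ^+ (j.-1 - i) * c ^+ i.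
have gc : g @ c --> g c.
  rewrite /g; elim: (index_enum _) => [|i l IH].
    by rewrite big_nil; under eq_fun do rewrite big_nil; exact: cvg_cst.
  rewrite big_cons; under eq_fun do rewrite big_cons.
  by apply: cvgD => //; apply: cvgMl; exact: exprn_continuous.
have gcE : g c = j%:R * c ^+ j.-1.
  rewrite /g (eq_bigr (fun=> c ^+ j.-1)).
    by rewrite sumr_const card_ord mulr_natl.
  move=> i _; rewrite -exprD subnK//; case: j i {g gc} => [[]//|j] i.
  by rewrite -ltnS.
move/cvgrPdist_le : gc => /(_ e e0); apply: filterS => s.
rewrite -gcE subrXX -mulrBr normrM mulrC distrC => gs.
by rewrite ler_wpM2r.
Qed.

Let segment_U (x y : 'rV[R]_n) : Prop :=
  forall s : R, 0 <= s <= 1 -> U (y + s *: (x - y)).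

(** The derivative of G_a along a segment of U, which may lie in the boundary. *)
Lemma near_path_member a y w (c e : R) : leq_ext (msize a).+1 k -> 0 < e ->
  U (y + c *: w) ->
  \forall s \near c, U (y + s *: w) ->
  q (G a (y + s *: w) - G a (y + c *: w) -
     (s - c) *: \sum_i w 0 i *: G (a + munit i) (y + c *: w)) <= e * `|s - c|.
Proof.
move=> ak e0 Uc; have w1 : 0 < `|w| + 1 by rewrite ltr_wpDl.
have [r r0 rP] := strict_derivative lcU diU GP ak Uc qs (divr_gt0 e0 w1).
have yc : y + s *: w @[s --> c] --> y + c *: w.
  by apply: cvgD; [exact: cvg_cst|apply: cvgZr_tmp; exact: cvg_id].
move/cvgrPdist_lt : yc => /(_ r r0); apply: filterS => s; rewrite distrC => sr Us.
have := rP _ _ Us Uc sr; rewrite subrr normr0 => /(_ r0).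
rewrite opprD addrACA subrr add0r -scalerBl normrZ.
under eq_bigr do rewrite mxE -scalerA.
rewrite -scaler_sumr => /le_trans; apply.
rewrite mulrCA mulrC ler_wpM2r// -mulrA ger_pMr//.
by rewrite mulrC ler_pdivrMr// mul1r lerDl.
Qed.

Lemma near_path_polynomial m (C : mindex n -> E) (w : 'rV[R]_n) (c e : R) : 0 < e ->
  \forall s \near c,
  q (\sum_(b <- mindices n m.+1) (mpow (s *: w) b / (mfact b)%:R) *: C b -
     \sum_(b <- mindices n m.+1) (mpow (c *: w) b / (mfact b)%:R) *: C b -
     (s - c) *: \sum_i w 0 i *: \sum_(b <- mindices n m)
       (mpow (c *: w) b / (mfact b)%:R) *: C (b + munit i)) <= e * `|s - c|.
Proof.
move=> e0; pose C' b := (mpow w b / (mfact b)%:R) *: C b.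
pose Q := \sum_(b <- mindices n m.+1) q (C' b).
have Q0 : 0 <= Q by apply: sumr_ge0 => b _; exact: seminorm_ge0.
have Q1 : 0 < Q + 1 by rewrite ltr_wpDl.
have : \forall s \near c, forall j : 'I_m.+2,
    `|s ^+ j - c ^+ j - (s - c) * (j%:R * c ^+ j.-1)| <= e / (Q + 1) * `|s - c|.
  apply: (@filter_forall _ _ (fun (j : 'I_m.+2) s => `|s ^+ j - c ^+ j -
    (s - c) * (j%:R * c ^+ j.-1)| <= e / (Q + 1) * `|s - c|) (nbhs c)) => j.
  by apply: near_exprn; exact: divr_gt0.
apply: filterS => s sj.
rewrite -taylor_polynomial_derivative scaler_sumr -!sumrB.
apply: (le_trans (seminorm_sum qs _ _ _)).
apply: (@le_trans _ _ (\sum_(b <- mindices n m.+1) e / (Q + 1) * `|s - c| * q (C' b))).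
  rewrite !big_seq; apply: ler_sum => b; rewrite mem_mindices => bm.
  rewrite [X in q X](_ : _ = (s ^+ msize b - c ^+ msize b -
      (s - c) * ((msize b)%:R * c ^+ (msize b).-1)) *: C' b).
    rewrite (seminormZ qs) ler_wpM2r ?(seminorm_ge0 qs)//.
    by have := sj (Ordinal (bm : msize b < m.+2)%N).
  rewrite /C' !mpowZ !scalerA -scalerBl -[LHS]scalerBl; congr (_ *: _); ring.
rewrite -mulr_sumr -/Q mulrAC ler_wpM2r// mulrAC -mulrA ger_pMr//.
by rewrite ler_pdivrMr// mul1r lerDl.
Qed.

(** By induction on m: along the segment from y to x, the derivative of the
   remainder of order m + 1 at a is the combination of the remainders of order m
   at the a + e_i with coefficients x - y. *)
Lemma taylor_estimate m a (x y : 'rV[R]_n) M : leq_ext (msize a + m)%N k ->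
  0 <= M -> segment_U x y ->
  (forall b (s : R), msize b = (msize a + m)%N -> 0 <= s <= 1 ->
    q (G b (y + s *: (x - y)) - G b y) <= M) ->
  q (taylor_remainder m a y x) <= (n%:R * `|x - y|) ^+ m * M.
Proof.
elim: m a x y => [|m IH] a x y ak M0 sU GM.
  rewrite expr0 mul1r /taylor_remainder sum_mindices0 mpowx0 mfact0 divr1.
  rewrite scale1r addr0 -[in X in G a X - _](subrKC y x) -[x - y]scale1r.
  by apply: GM; rewrite ?addn0// lexx ler01.
pose w := x - y.
have mul01 (s c : R) : 0 <= s <= 1 -> 0 <= c <= 1 -> 0 <= s * c <= 1.
  by move=> /andP[s0 s1] /andP[c0 c1]; rewrite mulr_ge0//= mulr_ile1.
have ak1 : leq_ext (msize a).+1 k.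
  by apply: leq_extW ak; rewrite addnS ltnS leq_addr.
have nw0 : 0 <= n%:R * `|w| by rewrite mulr_ge0.
pose phi s := taylor_remainder m.+1 a y (y + s *: w).
pose dphi s := \sum_i w 0 i *: taylor_remainder m (a + munit i) y (y + s *: w).
have yK s : y + s *: w - y = s *: w by rewrite addrC addKr.
have := @mean_value_segment _ _ q qs phi dphi ((n%:R * `|w|) ^+ m.+1 * M).
rewrite /phi scale1r scale0r addr0 taylor_remainderyy subr0 subrKC.
apply => [c e c01 e0|c c01].
  have e20 : 0 < e / 2 by rewrite divr_gt0.
  apply: filterS2 (near_path_member ak1 e20 (sU c c01))
    (near_path_polynomial m (fun b => G (a + b) y) w c e20) => s h1 h2 s01.
  move: h1 => /(_ (sU s s01)) h1.
  have -> : dphi c = \sum_i w 0 i *: G (a + munit i) (y + c *: w) -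
      \sum_i w 0 i *: \sum_(b <- mindices n m)
        (mpow (c *: w) b / (mfact b)%:R) *: G (a + (b + munit i)) y.
    rewrite /dphi -sumrB; apply: eq_bigr => i _.
    rewrite /taylor_remainder yK scalerBr; congr (_ - _ *: _).
    by apply: eq_bigr => b _; rewrite [b + _]addrC addrA.
  rewrite /taylor_remainder !yK [(s - c) *: _]scalerBr.
  set g1 := G a _ in h1 *; set g2 := G a _ in h1 *; set g3 := _ *: _ in h1 *.
  set p1 := \sum_(_ <- _) _ in h2 *; set p2 := \sum_(_ <- _) _ in h2 *.
  set p3 := _ *: _ in h2.
  rewrite [X in q X](_ : _ = g1 - g2 - g3 - (p1 - p2 - p3)).
    by rewrite (le_trans (seminormB qs _ _))// [e]splitr mulrDl lerD.
  have swap (g h g' h' : E) : g - h - (g' - h') = g - g' - (h - h').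
    by rewrite opprD addrACA -opprD.
  by rewrite (swap g1) (swap (g1 - g2)).
apply: (@le_trans _ _ (n%:R * `|w| * ((n%:R * `|w|) ^+ m * M))); last first.
  by rewrite exprS mulrA.
apply: seminorm_lincomb_le => // i.
have cw : y + c *: w - y = c *: w by [].
apply: (@le_trans _ _ ((n%:R * `|y + c *: w - y|) ^+ m * M)).
  apply: IH => //; first by rewrite msizeS addSnnS.
    move=> s s01; rewrite yK scalerA; by apply: sU; exact: mul01.
  move=> b s bs s01; rewrite yK scalerA; apply: GM; last exact: mul01.
  by rewrite bs msizeS addSnnS.
rewrite ler_wpM2r// yK lerXn2r ?nnegrE ?mulr_ge0// ler_wpM2l// normrZ ler_piMl//.
by case/andP: c01 => c0 c1; rewrite ger0_norm.
Qed.

End taylor_estimate.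

(** * Compact subsets of U *)

Section compact_subsets.
Context {R : realType} {n : nat} (U : set 'rV[R]_n).

Lemma val_continuous : continuous (val : U -> 'rV[R]_n).
Proof. exact: initial_continuous. Qed.

Lemma near_val (z : U) r : 0 < r -> \forall x \near z, `|val x - val z| < r.
Proof.
move=> r0; have /cvgrPdist_lt/(_ r r0) := @val_continuous z.
by apply: filterS => x; rewrite distrC.
Qed.

Lemma nbhs_val (z : U) (A : set U) : nbhs z A ->
  exists2 r, 0 < r & forall x : U, `|val x - val z| < r -> A x.
Proof.
move=> [B [[C oC <-] /= Cz] CA]; have : nbhs (val z) C by exact: open_nbhs_nbhs.
by move=> /nbhs_norm_lt[r r0 rC]; exists r => // x /rC Cx; exact: CA.
Qed.

(** The number d is a Lebesgue number of the cover of K by the balls given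
   by the hypothesis. *)
Lemma compact_uniform (P : 'rV[R]_n -> 'rV[R]_n -> Prop) (K : set U) :
  compact K ->
  (forall z : U, exists2 r, 0 < r & forall x y : U,
     `|val x - val z| < r -> `|val y - val z| < r -> P (val x) (val y)) ->
  exists2 d, 0 < d & forall x y : U, K y -> `|val x - val y| < d ->
    P (val x) (val y).
Proof.
move=> /compact_near_coveringP cK zP.
pose Q (d : R) (y : U) := forall x : U, `|val x - val y| < d -> P (val x) (val y).
have : \forall d \near (0 : R)^'+, K `<=` Q d.
  apply: cK => z Kz; have [r r0 rP] := zP z.
  have r20 : 0 < r / 2 by rewrite divr_gt0.
  near=> y d.
  have yz : `|val y - val z| < r / 2 by [near: y; exact: near_val].
  have dr : d < r / 2 by [near: d; exact: nbhs_right_lt].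
  move=> x xy; apply: rP.
    rewrite -[_ - _](subrKA (val y)) (le_lt_trans (ler_normD _ _))// [ltRHS]splitr.
    by rewrite ltrD// (lt_trans xy).
  by rewrite (lt_trans yz)// ltr_pdivrMr// ltr_pMr// ltr1n.
move=> KQ; have : \forall d \near (0 : R)^'+, 0 < d /\ K `<=` Q d.
  by near=> d; split; near: d => //; exact: nbhs_right_gt.
by move=> /filter_ex[d [d0 dQ]]; exists d => // x y /dQ; apply.
Unshelve. all: by end_near. Qed.

Lemma compact_cvg_seq (x : nat -> U) (z : U) :
  x @ \oo --> z -> compact (z |` range x).
Proof.
move=> xz F FF FK; apply: contrapT => noz.
have : ~ cluster F z by move=> Fz; apply: noz; exists z; split => //; left.
move=> /existsNP[A /existsNP[B /not_implyP[FA /not_implyP[Bz AB]]]].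
have [N _ NB] := xz B Bz.
have finS : finite_set [set x j | j in `I_N].
  exact/finite_image/finite_II.
have /(_ F FF) : compact [set x j | j in `I_N] by exact: finite_compact.
case.
  apply: filterS (filterI FA FK) => y [Ay [yz|[j _ xj]]].
    exfalso; apply: AB; exists y; split => //.
    by rewrite yz; exact: nbhs_singleton.
  exists j => //=; rewrite ltnNge; apply/negP => Nj; apply: AB; exists y.
  by split => //; rewrite -xj; exact: NB.
move=> y [[j _ xj] Fy]; apply: noz; exists y; split => //.
by right; exists j.
Qed.

Lemma compact_val_preimage (A : set 'rV[R]_n) : A `<=` U -> compact A ->
  compact (val @^-1` A : set U).
Proof.
move=> AU cA F FF FA.
have [p [Ap Fp]] := cA (val @ F) _ FA.
have Up := AU p Ap; exists (SigSub (mem_set Up)); split => //= B C FB.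
move=> /nbhs_val[r r0 rC].
have [||_ [[y By <-] yr]] := Fp (val @` B) [set y | `|y - p| < r].
- by rewrite nbhs_simpl/=; apply: filterS FB => y By; exists y.
- by apply/nbhs_ballP; exists r => //= y; rewrite -ball_normE/= distrC.
- by exists y; split => //; exact: rC.
Qed.

End compact_subsets.

(** * Whitney jets and derivative families *)

Section enorm_theory.
Context {R : realType} {n : nat}.
Implicit Types x : 'rV[R]_n.

Lemma enorm_ge0 x : 0 <= enorm x.
Proof. exact: sqrtr_ge0. Qed.

Lemma coord_le_enorm x i : `|x 0 i| <= enorm x.
Proof.
rewrite -sqrtr_sqr /enorm ler_sqrt ?sumr_ge0//; last by move=> j _; exact: sqr_ge0.
by rewrite (bigD1 i)//= lerDl sumr_ge0// => j _; exact: sqr_ge0.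
Qed.

Lemma norm_le_enorm x : `|x| <= enorm x.
Proof.
rewrite [leLHS]mx_normrE; apply: bigmax_le; first exact: enorm_ge0.
by move=> [i j] _; rewrite (ord1 i); exact: coord_le_enorm.
Qed.

Lemma enorm_le x : enorm x <= n%:R * `|x|.
Proof.
rewrite -[leRHS]ger0_norm ?mulr_ge0// -sqrtr_sqr /enorm ler_sqrt ?sqr_ge0//.
apply: (@le_trans _ _ (\sum_(i < n) `|x| ^+ 2)).
  apply: ler_sum => i _; rewrite -real_normK ?num_real// lerXn2r ?nnegrE//.
  exact: coord_le_norm.
rewrite sumr_const card_ord exprMn -[leLHS]mulr_natl ler_wpM2r ?sqr_ge0//.
by rewrite -natrX ler_nat; case: (n) => // m; rewrite expnS leq_pmulr// expn1.
Qed.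

Lemma enorm_eq0 x : (enorm x == 0) = (x == 0).
Proof.
apply/eqP/eqP => [x0|->].
  by apply/eqP; rewrite -normr_le0 -x0 norm_le_enorm.
by apply/eqP; rewrite eq_le enorm_ge0 andbT (le_trans (enorm_le _))// normr0 mulr0.
Qed.

Lemma enormZ c x : enorm (c *: x) = `|c| * enorm x.
Proof.
rewrite /enorm -sqrtr_sqr -sqrtrM ?sqr_ge0// mulr_sumr.
by congr Num.sqrt; apply: eq_bigr => i _; rewrite mxE exprMn.
Qed.

Lemma norm_mpow_le x b : `|mpow x b| <= enorm x ^+ msize b.
Proof.
rewrite /mpow /msize -prodrXr normr_prod; apply: ler_prod => i _.
by rewrite normr_ge0 normrX lerXn2r ?nnegrE ?enorm_ge0//= coord_le_enorm.
Qed.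

End enorm_theory.

Lemma near_all_seq (T : Type) (F : set_system T) {FF : Filter F} (I : eqType)
    (s : seq I) (P : I -> T -> Prop) :
  (forall i, i \in s -> \forall x \near F, P i x) ->
  \forall x \near F, forall i, i \in s -> P i x.
Proof.
elim: s => [|i s IH] sP; first by near=> x.
have h1 := sP i (mem_head _ _).
have h2 : \forall x \near F, forall j, j \in s -> P j x.
  by apply: IH => j js; apply: sP; rewrite inE js orbT.
near=> x => j; rewrite inE => /orP[/eqP ->|]; first by near: x.
by move: j; near: x.
Unshelve. all: by end_near. Qed.

Lemma segmentE (R : realType) (V : lmodType R) (x y : V) (s : R) :
  y + s *: (x - y) = s *: x + (1 - s) *: y.
Proof. by rewrite scalerBr scalerBl scale1r addrCA. Qed.

Lemma taylor_remainder1 {R : realType} {E : hausdorffTvsType R} {n : nat}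
    (G : mindex n -> 'rV[R]_n -> E) a x y :
  taylor_remainder G 1 a y x =
  G a x - G a y - \sum_i (x - y) 0 i *: G (a + munit i) y.
Proof.
rewrite /taylor_remainder -addrA -opprD; congr (_ - _).
have := taylor_polynomial_derivative 0 1 (x - y) (fun b => G (a + b) y).
under [X in _ = X -> _]eq_bigr do rewrite sum_mindices0 mpowx0 mfact0 divr1 scale1r add0r.
move=> <-; rewrite !(bigD1_seq 0 (F := fun b => _ *: G (a + b) y))
  ?mindices_uniq ?mem_mindices ?msize0//=.
rewrite mpowx0 mfact0 divr1 scale1r addr0 !mul0r scale0r add0r; congr (_ + _).
rewrite !(big_seq_cond (fun b => b != 0)); apply: eq_bigr => b /andP[].
rewrite mem_mindices -msize_eq0 -lt0n => b1 b0.
by rewrite (_ : msize b = 1%N) ?expr0 ?mul1r//; apply/eqP; rewrite eqn_leq b1.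
Qed.

Section whitney_family.
Context {R : realType} {E : hausdorffTvsType R} {n : nat}.
Context (k : option nat) (U : set 'rV[R]_n).
Implicit Types (F : jet k U E) (a b : mindex n) (x y z : U).

Definition jet_ext F a : 'rV[R]_n -> E := ext0 (jcoef F a).

Lemma remainderE F l a y x : remainder F l a y x =
  taylor_remainder (jet_ext F) (l - msize a) a (val y) (val x).
Proof.
rewrite /remainder /taylor_remainder /jet_ext ext0E; congr (_ - _).
by apply: eq_bigr => b _; rewrite ext0E.
Qed.

(** In a small ball of U, which is convex, the Taylor estimate applies with a
   bound for the oscillation of the G_b, |b| = l; finitely many such balls
   suffice for K. *)
Lemma family_whitney F : locally_convex_subset U -> dense_interior U ->
  derivative_family k U (jet_ext F) -> is_whitney F.
Proof.
move=> lcU diU FP l a q K e lk al qs cK e0; set m := (l - msize a)%N.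
have aml : (msize a + m = l)%N by rewrite subnKC.
pose C : R := n%:R ^+ m + 1; have C0 : 0 < C by rewrite ltr_wpDl ?exprn_ge0.
pose e' := e / C; have e'0 : 0 < e' by exact: divr_gt0.
have e'20 : 0 < e' / 2 by exact: divr_gt0.
have [z|d d0 dP] := @compact_uniform _ _ U (fun u w =>
    q (taylor_remainder (jet_ext F) m a w u) <= e * enorm (u - w) ^+ m) K cK.
  have Uz : U (val z) by exact: set_valP.
  have [r0 r00 r0P] := small_balls_convex lcU diU Uz.
  have : \forall y \near within U (nbhs (val z)), forall b, b \in mindices n l ->
      q (jet_ext F b y - jet_ext F b (val z)) < e' / 2.
    apply: near_all_seq => b; rewrite mem_mindices => bl.
    apply: seminorm_cvg => //; apply: within_cvg => //; apply: FP.1.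
    exact: leq_extW lk.
  rewrite near_withinE => /nbhs_norm_lt[r1 r10 r1P].
  pose r := Num.min r0 r1; have r_gt0 : 0 < r by rewrite lt_min r00.
  have rr0 : r <= r0 by rewrite ge_min lexx.
  have rr1 : r <= r1 by rewrite ge_min lexx orbT.
  have [cV _] := r0P r r_gt0 rr0; exists r => // x y xr yr.
  have Ux : U (val x) by exact: set_valP.
  have Uy : U (val y) by exact: set_valP.
  have seg s : 0 <= s <= 1 -> (U `&` [set w | `|w - val z| < r])
      (val y + s *: (val x - val y)).
    by move=> s01; rewrite segmentE; exact: cV.
  apply: (le_trans (taylor_estimate lcU diU FP qs (M := e') _ _ _ _)).
  - by rewrite aml.
  - exact: ltW.
  - by move=> s /seg[].
  - move=> b s; rewrite aml => bl /seg[Us sr].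
    rewrite (le_trans (seminorm_tri qs (jet_ext F b (val z)) _ _))// [e']splitr.
    rewrite lerD//; last rewrite (seminormBC qs).
      by rewrite ltW// r1P ?mem_mindices ?bl// (lt_le_trans sr).
    by rewrite ltW// r1P ?mem_mindices ?bl// (lt_le_trans yr).
  - rewrite exprMn mulrAC; apply: ler_pM; rewrite ?exprn_ge0//.
    + by apply: mulr_ge0; [exact: exprn_ge0|exact: ltW].
    + by rewrite /e' mulrCA ger_pMr// ler_pdivrMr// mul1r lerDl.
    by rewrite lerXn2r ?nnegrE ?enorm_ge0// norm_le_enorm.
exists d => // x y Kx Ky /andP[_ xyd]; rewrite remainderE; apply: dP => //.
exact: le_lt_trans (norm_le_enorm _) xyd.
Qed.

(** A sequence violating the estimate would converge to z and hence, together
   with z, form a compact subset of U. *)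
Lemma whitney_pointwise F z l a q e : is_whitney F ->
  leq_ext l k -> (msize a <= l)%N -> cont_seminorm q -> 0 < e ->
  \forall x \near z, q (remainder F l a z x) <=
    e * enorm (val x - val z) ^+ (l - msize a).
Proof.
move=> Fw lk al qs e0; apply: contrapT => noz.
have : forall j : nat, exists x : U, `|val x - val z| < j.+1%:R^-1 /\
    ~ (q (remainder F l a z x) <= e * enorm (val x - val z) ^+ (l - msize a)).
  move=> j; apply: contrapT => nox; apply: noz.
  have j0 : 0 < j.+1%:R^-1 :> R by rewrite invr_gt0.
  apply: filterS (near_val z j0) => x xz; apply: contrapT => xq.
  by apply: nox; exists x.
move=> /choice[x_ x_P].
have x_z : x_ @ \oo --> z.
  move=> B /nbhs_val[r r0 rB]; have [N _ NP] := near_infty_natSinv_lt (PosNum r0).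
  by exists N => // j /= Nj; apply: rB; exact: lt_trans (x_P j).1 (NP j Nj).
have [d d0 dP] := Fw l a q _ e lk al qs (compact_cvg_seq x_z) e0.
have [j jd] : exists j : nat, enorm (val (x_ j) - val z) < d.
  have n1 : 0 < n%:R + 1 :> R by rewrite ltr_wpDl.
  have [N _ NP] := near_infty_natSinv_lt (PosNum (divr_gt0 d0 n1)).
  exists N; rewrite (le_lt_trans (enorm_le _))//.
  apply: (@le_lt_trans _ _ ((n%:R + 1) * `|val (x_ N) - val z|)).
    by rewrite ler_wpM2r// lerDl.
  rewrite mulrC -ltr_pdivlMr//; apply: (lt_trans (x_P N).1).
  exact: (NP N (leqnn N)).
apply: (x_P j).2; have [xz|xz] := eqVneq (enorm (val (x_ j) - val z)) 0.
  move/eqP : (xz); rewrite enorm_eq0 subr_eq0 => /eqP/val_inj ->.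
  rewrite remainderE taylor_remainderyy (seminorm0 qs) mulr_ge0 ?(ltW e0)//.
  by rewrite exprn_ge0// enorm_ge0.
apply: dP; [by right; exists j|by left|].
by rewrite jd andbT lt0r xz enorm_ge0.
Unshelve. all: by end_near. Qed.

(** The Whitney conditions of orders |a| and |a| + 1 for the component a are its
   continuity and its first order Taylor expansion. *)
Lemma whitney_family F : is_whitney F -> derivative_family k U (jet_ext F).
Proof.
move=> Fw; split=> [a ak|a v z0 ak Uz].
  apply: continuous_ext0 => z.
  apply: (@cvg_seminorm _ _ _ (nbhs z) (nbhs_filter z)) => q e qs e0.
  apply: filterS (whitney_pointwise z Fw ak (leqnn _) qs e0) => x.
  rewrite /remainder subnn sum_mindices0 mpowx0 mfact0 divr1 scale1r addr0.
  by rewrite expr0 mulr1.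
pose z : U := SigSub (mem_set (interior_subset Uz)).
apply/is_dirDP => q e qs e0.
have v1 : 0 < enorm v + 1 by rewrite ltr_wpDl// enorm_ge0.
have /nbhs_val[r r0 rP] := whitney_pointwise z Fw ak (leqnSn _) qs (divr_gt0 e0 v1).
have tv : z0 + t *: v @[t --> (0 : R)] --> z0.
  have : z0 + t *: v @[t --> (0 : R)] --> z0 + 0 *: v.
    by apply: cvgD; [exact: cvg_cst|apply: cvgZr_tmp; exact: cvg_id].
  by rewrite scale0r addr0.
have nr : \forall x \near z0, `|x - z0| < r.
  by apply/nbhs_ballP; exists r => //= x; rewrite -ball_normE/= distrC.
near=> t.
have Ut : U (z0 + t *: v).
  apply: interior_subset; near: t; exact: (tv _ (near_interior Uz)).
have tr : `|z0 + t *: v - z0| < r by near: t; exact: (tv _ nr).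
have := rP (SigSub (mem_set Ut)) tr; rewrite remainderE subSnn taylor_remainder1/=.
rewrite expr1 -[z0 + _ - _]addrAC subrr add0r enormZ.
under eq_bigr do rewrite mxE -scalerA.
rewrite -scaler_sumr => /le_trans; apply.
rewrite mulrCA mulrC ler_wpM2r// -mulrA ger_pMr//.
by rewrite mulrC ler_pdivrMr// mul1r lerDl.
Unshelve. all: by end_near. Qed.

End whitney_family.

(** * Comparison of the two families of seminorms *)

Section whitney_seminorms.
Context {R : realType} {E : hausdorffTvsType R} {n : nat}.
Context (k : option nat) (U : set 'rV[R]_n).
Hypotheses (lcU : locally_convex_subset U) (diU : dense_interior U).
Implicit Types (F G : whitney k U E) (a b : mindex n) (x y z : U) (K : set U).
Implicit Types (l : nat) (q : E -> R).

Lemma whitneyP F : is_whitney F.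
Proof. by case: F => F /= /asboolP. Qed.

Lemma whitney_jet_family F : derivative_family k U (jet_ext F).
Proof. exact/whitney_family/whitneyP. Qed.

Lemma sup_le_ge0 (A : set R) (c : R) : 0 <= c -> (forall r, A r -> r <= c) -> sup A <= c.
Proof.
move=> c0 Ac; have [->|/set0P A0] := eqVneq A set0; first by rewrite sup0.
exact: ge_sup.
Qed.

Lemma compact_seminorm_ub (f : U -> E) q K : cont_seminorm q -> continuous f ->
  compact K -> has_ubound [set q (f x) | x in K].
Proof.
move=> qs fc /compact_near_coveringP cK.
have : \forall M \near +oo, K `<=` (fun x => q (f x) <= M).
  apply: cK => z Kz; near=> x M.
  have zM : q (f z) + 1 <= M.
    by near: M; apply: nbhs_pinfty_ge; exact: num_real.
  have fx : q (f x - f z) < 1.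
    by near: x; apply: (@seminorm_cvg _ _ q _ (nbhs z)) => //; exact: fc.
  rewrite (le_trans _ zM)// -[f x](subrK (f z)) (le_trans (seminormD qs _ _))//.
  by rewrite addrC lerD2l ltW.
move=> /filter_ex[M MP]; exists M => _ [x Kx <-]; exact: MP.
Unshelve. all: by end_near. Qed.

Lemma jcoef_continuous F a : leq_ext (msize a) k -> continuous (jcoef F a).
Proof.
move=> ak; have := (whitney_jet_family F).1 a ak.
by move=> /subspace_valL_continuousP'.
Qed.

Lemma whitney_seminorm'_ge0 l q K F : 0 <= whitney_seminorm' l q K F.
Proof. exact: bigmax_ge_id. Qed.

Lemma whitney_seminorm'_ge l q K F a x : leq_ext l k -> cont_seminorm q ->
  compact K -> (msize a <= l)%N -> K x ->
  q (jcoef F a x) <= whitney_seminorm' l q K F.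
Proof.
move=> lk qs cK al Kx; apply: le_trans (_ : _ <= sup [set q (jcoef F a x) | x in K]) _.
  apply: ub_le_sup; last by exists x.
  by apply: compact_seminorm_ub => //; apply: jcoef_continuous; exact: leq_extW lk.
apply: (le_bigmax_seq 0 a xpredT (fun a => sup [set q (jcoef F a x) | x in K])) => //.
by rewrite mem_mindices.
Qed.

Lemma whitney_seminorm'_le l q K F c : 0 <= c ->
  (forall a x, (msize a <= l)%N -> K x -> q (jcoef F a x) <= c) ->
  whitney_seminorm' l q K F <= c.
Proof.
move=> c0 h; rewrite /whitney_seminorm' big_seq_cond; apply: bigmax_le => // a.
rewrite mem_mindices andbT => al; apply: sup_le_ge0 => // _ [x Kx <-]; exact: h.
Qed.

Definition remainder_ratio l q F a y x : R :=
  q (remainder F l a y x) / enorm (val x - val y) ^+ (l - msize a).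

(** The second summand of whitney_seminorm. *)
Definition ratio_seminorm l q K F : R :=
  \big[Num.max/0]_(a <- mindices n l)
    sup [set r | exists x y, [/\ K x, K y, x != y & r = remainder_ratio l q F a y x]].

Lemma whitney_seminormE l q K F :
  whitney_seminorm l q K F = whitney_seminorm' l q K F + ratio_seminorm l q K F.
Proof. by []. Qed.

Lemma ratio_seminorm_le l q K F c : 0 <= c ->
  (forall a x y, (msize a <= l)%N -> K x -> K y -> x != y ->
     remainder_ratio l q F a y x <= c) ->
  ratio_seminorm l q K F <= c.
Proof.
move=> c0 h; rewrite /ratio_seminorm big_seq_cond; apply: bigmax_le => // a.
rewrite mem_mindices andbT => al; apply: sup_le_ge0 => // _ [x [y [Kx Ky xy ->]]].
exact: h.
Qed.

(** K' consists of the segments between points of K at distance at most d. It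
   is contained in U, as U is convex near each point of K. *)
Lemma segment_neighbourhood K : compact K -> exists d (K' : set U), [/\ 0 < d,
  compact K', K `<=` K' & forall x y, K x -> K y -> `|val x - val y| <= d ->
    forall s : R, 0 <= s <= 1 -> exists2 z, K' z & val z = val y + s *: (val x - val y)].
Proof.
move=> cK.
have [z|d d0 dP] := @compact_uniform _ _ U (fun u w =>
    forall s : R, 0 <= s <= 1 -> U (w + s *: (u - w))) K cK.
  have [r r0 /(_ r r0 (lexx _))[cV _]] := small_balls_convex lcU diU (set_valP z).
  exists r => // x y xr yr s s01; rewrite segmentE.
  have Ux : U (val x) by exact: set_valP.
  have Uy : U (val y) by exact: set_valP.
  by have [] := cV _ _ s (conj Ux xr) (conj Uy yr) s01.
have d20 : 0 < d / 2 by rewrite divr_gt0.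
have d2d : d / 2 < d by rewrite ltr_pdivrMr// ltr_pMr// ltr1n.
pose VK : set 'rV[R]_n := [set val x | x in K].
have cVK : compact VK.
  by apply: continuous_compact => //; apply: continuous_subspaceT; exact: val_continuous.
pose T := (VK `*` VK) `&` [set p | `|p.1 - p.2| <= d / 2].
have cT : compact T.
  apply: compact_closedI; first exact: compact_setX.
  have dist_cont : continuous (fun p : 'rV[R]_n * 'rV[R]_n => `|p.1 - p.2|).
    move=> p; apply: (@cvg_norm _ _ _ _ _ (fun p : 'rV[R]_n * 'rV[R]_n => p.1 - p.2)).
    by apply: cvgB; [exact: cvg_fst|exact: cvg_snd].
  apply: (@preimage_closed _ _ (fun p : 'rV[R]_n * 'rV[R]_n => `|p.1 - p.2|)
    [set r | r <= d / 2]); last exact: closed_le.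
  by move=> p _; exact: dist_cont.
pose f (p : ('rV[R]_n * 'rV[R]_n) * R) := p.1.2 + p.2 *: (p.1.1 - p.1.2).
have fc : continuous f.
  move=> p; apply: cvgD.
    exact: (@cvg_comp _ _ _ fst snd _ (nbhs p.1) _ cvg_fst cvg_snd).
  apply: cvgZ; first exact: cvg_snd.
  apply: cvgB.
    exact: (@cvg_comp _ _ _ fst fst _ (nbhs p.1) _ cvg_fst cvg_fst).
  exact: (@cvg_comp _ _ _ fst snd _ (nbhs p.1) _ cvg_fst cvg_snd).
pose A := [set f p | p in T `*` `[0, 1]%classic].
have cA : compact A.
  apply: continuous_compact; first exact: continuous_subspaceT.
  by apply: compact_setX => //; exact: segment_compact.
have AU : A `<=` U.
  move=> _ [[[u w] s] [[[[x Kx xu] [y Ky yw]] xyd] s01] <-]; rewrite /f/=.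
  move: xu yw xyd s01; rewrite /= in_itv/= => <- <- xyd s01.
  by apply: dP => //; exact: le_lt_trans d2d.
have KA x y (s : R) : K x -> K y -> `|val x - val y| <= d / 2 -> 0 <= s <= 1 ->
    A (val y + s *: (val x - val y)).
  move=> Kx Ky xyd s01; exists ((val x, val y), s) => //; split; last by rewrite /= in_itv.
  by split => //; split; [exists x|exists y].
exists (d / 2), (val @^-1` A); split => //.
- exact: compact_val_preimage.
- move=> x Kx /=; have := KA x x 0 Kx Kx; rewrite subrr scaler0 addr0 normr0.
  by apply; [exact: ltW|rewrite lexx ler01].
- move=> x y Kx Ky xyd s s01; have As := KA x y s Kx Ky xyd s01.
  by exists (SigSub (mem_set (AU _ As))).
Qed.

(** For nearby points the Taylor estimate bounds the quotients by values of the
   derivatives on the segments between points of K; for the others, each term of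
   the remainder is bounded separately, the distance being bounded below. *)
Lemma remainder_ratio_estimate l q K : leq_ext l k -> cont_seminorm q ->
  compact K -> exists (K' : set U) (C : R), [/\ compact K', 0 <= C &
    forall F a x y, (msize a <= l)%N -> K x -> K y -> x != y ->
      remainder_ratio l q F a y x <= C * whitney_seminorm' l q K' F].
Proof.
move=> lk qs cK; have [d [K' [d0 cK' KK' segK]]] := segment_neighbourhood cK.
have d1 : 1 <= 1 + d^-1 by rewrite lerDl invr_ge0 ltW.
(* C1 m is for points at distance at most d, with 2 bounding an oscillation by
   twice a supremum. For a larger distance D, the estimate D^j <= (1 + d^-1)^m D^m
   for j <= m bounds the terms of the remainder; C2 m counts them. *)
pose C1 m : R := n%:R ^+ m * 2.
pose C2 m : R := (1 + d^-1) ^+ m * (1 + (size (mindices n m))%:R).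
have C10 m : 0 <= C1 m by rewrite mulr_ge0 ?exprn_ge0.
have C20 m : 0 <= C2 m.
  apply: mulr_ge0; last exact: addr_ge0.
  exact/exprn_ge0/(le_trans ler01 d1).
exists K', (\sum_(m < l.+1) (C1 m + C2 m)); split => //.
  by apply: sumr_ge0 => m _; rewrite addr_ge0.
move=> F a x y al Kx Ky xy; set m := (l - msize a)%N.
have aml : (msize a + m = l)%N by rewrite subnKC.
have ml : (m < l.+1)%N by rewrite ltnS leq_subr.
set S := whitney_seminorm' l q K' F.
have S0 : 0 <= S by exact: whitney_seminorm'_ge0.
have SE b z : (msize b <= l)%N -> K' z -> q (jcoef F b z) <= S.
  exact: whitney_seminorm'_ge.
rewrite (@le_trans _ _ ((C1 m + C2 m) * S))//; last first.
  rewrite ler_wpM2r// (bigD1 (Ordinal ml))//= lerDl sumr_ge0// => j _.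
  by rewrite addr_ge0.
pose D := enorm (val x - val y).
have D0 : 0 < D.
  by rewrite lt0r enorm_ge0 andbT enorm_eq0 subr_eq0 (inj_eq val_inj).
rewrite /remainder_ratio -/D -/m ler_pdivrMr ?exprn_gt0//.
have [xyd|xyd] := leP `|val x - val y| d.
  rewrite remainderE -/m (@le_trans _ _ ((n%:R * `|val x - val y|) ^+ m * (S + S)))//.
    apply: (taylor_estimate lcU diU (whitney_jet_family F) qs).
    - by rewrite aml.
    - exact: addr_ge0.
    - by move=> s /(segK x y Kx Ky xyd)[z _ <-]; exact: set_valP.
    - move=> b s; rewrite aml => bl /(segK x y Kx Ky xyd)[z K'z <-].
      rewrite /jet_ext !ext0E (le_trans (seminormB qs _ _))// lerD// SE ?bl//.
      exact: KK'.
  rewrite exprMn (@le_trans _ _ (n%:R ^+ m * D ^+ m * (S + S)))//.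
    rewrite ler_wpM2r ?addr_ge0// ler_wpM2l ?exprn_ge0// lerXn2r ?nnegrE ?(ltW D0)//.
    exact: norm_le_enorm.
  rewrite (_ : _ * (S + S) = C1 m * S * D ^+ m); last by rewrite /C1; ring.
  by rewrite ler_wpM2r ?exprn_ge0 ?(ltW D0)// ler_wpM2r// lerDl.
rewrite (@le_trans _ _ (C2 m * S * D ^+ m))//; last first.
  by rewrite ler_wpM2r ?exprn_ge0 ?(ltW D0)// ler_wpM2r// lerDr.
have dD : 1 <= (1 + d^-1) * D.
  rewrite mulrDl mul1r (le_trans _ (_ : d^-1 * D <= _))//; last by rewrite lerDr ltW.
  rewrite mulrC ler_pdivlMr// mul1r (le_trans (ltW xyd))//; exact: norm_le_enorm.
set X := (1 + d^-1) * D in dD.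
have X1 : 1 <= X ^+ m by exact: exprn_ege1.
rewrite (_ : C2 m * S * D ^+ m = X ^+ m * S + X ^+ m * S * (size (mindices n m))%:R);
  last by rewrite /C2 /X exprMn; ring.
rewrite /remainder -/m (le_trans (seminormB qs _ _))// lerD//.
  by rewrite (le_trans (SE a x al (KK' _ Kx)))// ler_peMl.
rewrite (le_trans (seminorm_sum qs _ _ _))//.
apply: (@le_trans _ _ (\sum_(b <- mindices n m) X ^+ m * S)); last first.
  by rewrite big_const_seq count_predT iter_addr_0 mulr_natr.
rewrite !big_seq; apply: ler_sum => b; rewrite mem_mindices => bm.
rewrite (seminormZ qs) ler_pM ?(seminorm_ge0 qs)//; last first.
  by apply: SE; [rewrite msizeD -aml leq_add2l|exact: KK'].
rewrite normrM normfV normr_nat (@le_trans _ _ `|mpow (val x - val y) b|)//.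
  rewrite ler_pdivrMr ?ltr0n ?lt0n -?(pnatr_eq0 R) ?mfact_neq0//.
  rewrite ler_peMr// ler1n lt0n -(pnatr_eq0 R) mfact_neq0//.
rewrite (le_trans (norm_mpow_le _ _))// -/D (@le_trans _ _ (X ^+ msize b))//.
  rewrite lerXn2r ?nnegrE ?(ltW D0)// ?(le_trans ler01 dD)//.
  by rewrite /X ler_peMl ?(ltW D0).
exact: ler_weXn2l.
Qed.

End whitney_seminorms.

Section seminorm_laws.
Context {R : realType} {E : hausdorffTvsType R} {n : nat}.
Context (k : option nat) (U : set 'rV[R]_n).
Hypotheses (lcU : locally_convex_subset U) (diU : dense_interior U).
Implicit Types (F G : whitney k U E) (a b : mindex n) (x y : U) (K : set U).
Variables (l : nat) (q : E -> R) (K : set U).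
Hypotheses (lk : leq_ext l k) (qs : cont_seminorm q) (cK : compact K).

Lemma whitney_val_lincomb c F G :
  whitney_val (c *: F + G) = c *: whitney_val F + whitney_val G.
Proof. exact: (linearP (val : whitney k U E -> jet k U E)). Qed.

Lemma jcoef_lincomb c F G a x :
  jcoef (c *: F + G) a x = c *: jcoef F a x + jcoef G a x.
Proof.
rewrite /jcoef whitney_val_lincomb.
by case: insub => [//|]; rewrite scaler0 addr0.
Qed.

Lemma jcoefD F G a x : jcoef (F + G) a x = jcoef F a x + jcoef G a x.
Proof. by have := jcoef_lincomb 1 F G a x; rewrite !scale1r. Qed.

Lemma jcoef0 a x : jcoef (0 : whitney k U E) a x = 0.
Proof. by apply: (addrI (jcoef (0 : whitney k U E) a x)); rewrite -jcoefD !addr0. Qed.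

Lemma remainder_ratio_ub F a : (msize a <= l)%N ->
  has_ubound [set r | exists x y,
    [/\ K x, K y, x != y & r = remainder_ratio l q F a y x]].
Proof.
move=> al; have [K' [C [_ _ CP]]] := remainder_ratio_estimate lcU diU lk qs cK.
exists (C * whitney_seminorm' l q K' F) => _ [x [y [Kx Ky xy ->]]].
exact: CP.
Qed.

Lemma ratio_seminorm_ge F a x y : (msize a <= l)%N -> K x -> K y -> x != y ->
  remainder_ratio l q F a y x <= ratio_seminorm l q K F.
Proof.
move=> al Kx Ky xy; pose A b := [set r | exists x y,
  [/\ K x, K y, x != y & r = remainder_ratio l q F b y x]].
apply: (@le_trans _ _ (sup (A a))).
  by apply: ub_le_sup; [exact: remainder_ratio_ub|exists x, y].
apply: (le_bigmax_seq 0 a xpredT (fun b => sup (A b))) => //.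
by rewrite mem_mindices.
Qed.

Lemma whitney_seminorm'D F G : whitney_seminorm' l q K (F + G) <=
  whitney_seminorm' l q K F + whitney_seminorm' l q K G.
Proof.
apply: whitney_seminorm'_le => [|a x al Kx].
  by rewrite addr_ge0 ?whitney_seminorm'_ge0.
rewrite jcoefD (le_trans (seminormD qs _ _))// lerD//.
- exact: whitney_seminorm'_ge.
- exact: whitney_seminorm'_ge.
Qed.

Lemma whitney_seminormD F G : whitney_seminorm l q K (F + G) <=
  whitney_seminorm l q K F + whitney_seminorm l q K G.
Proof.
rewrite !whitney_seminormE addrACA lerD ?whitney_seminorm'D//.
apply: ratio_seminorm_le => [|a x y al Kx Ky xy].
  by rewrite addr_ge0 ?bigmax_ge_id.
have -> : remainder_ratio l q (F + G) a y x =
    q (remainder F l a y x + remainder G l a y x) /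
    enorm (val x - val y) ^+ (l - msize a).
  rewrite /remainder_ratio; congr (q _ / _).
  have := remainder_lincomb 1 F G l a y x; rewrite !scale1r => <-.
  by have := whitney_val_lincomb 1 F G; rewrite !scale1r => <-.
have e0 : 0 <= (enorm (val x - val y) ^+ (l - msize a))^-1.
  by rewrite invr_ge0 exprn_ge0// enorm_ge0.
rewrite (le_trans (ler_wpM2r e0 (seminormD qs _ _)))// mulrDl lerD//.
- exact: ratio_seminorm_ge.
- exact: ratio_seminorm_ge.
Qed.

Lemma whitney_seminorm'0 : whitney_seminorm' l q K (0 : whitney k U E) <= 0.
Proof.
by apply: whitney_seminorm'_le => // a x _ _; rewrite jcoef0 (seminorm0 qs).
Qed.

Lemma whitney_seminorm'_le_whitney_seminorm F :
  whitney_seminorm' l q K F <= whitney_seminorm l q K F.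
Proof. by rewrite whitney_seminormE lerDl bigmax_ge_id. Qed.

Lemma whitney_seminorm_estimate : exists (K' : set U) (C : R),
  [/\ compact K', 0 <= C & forall F : whitney k U E,
    whitney_seminorm l q K F <= C * whitney_seminorm' l q K' F].
Proof.
have [K1 [C [cK1 C0 CP]]] := remainder_ratio_estimate lcU diU lk qs cK.
exists (K `|` K1), (1 + C); split.
- exact: compactU.
- exact: addr_ge0.
move=> F; set S := whitney_seminorm' _ _ (K `|` K1) F.
have SP K2 : K2 `<=` K `|` K1 -> whitney_seminorm' l q K2 F <= S.
  move=> K2S; apply: whitney_seminorm'_le => [|a x al /K2S Kx].
    exact: whitney_seminorm'_ge0.
  by apply: whitney_seminorm'_ge => //; exact: compactU.
rewrite whitney_seminormE mulrDl mul1r lerD//; first by apply: SP => x; left.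
apply: ratio_seminorm_le => [|a x y al Kx Ky xy].
  by rewrite mulr_ge0// whitney_seminorm'_ge0.
rewrite (le_trans (CP F a x y al Kx Ky xy))// ler_wpM2l//.
by apply: SP => z; right.
Qed.

Lemma whitney_seminorm0 : whitney_seminorm l q K (0 : whitney k U E) <= 0.
Proof.
have [K' [C [_ C0 /(_ 0) CP]]] := whitney_seminorm_estimate.
rewrite (le_trans CP)// mulr_ge0_le0//.
by apply: whitney_seminorm'_le => // a x _ _; rewrite jcoef0 (seminorm0 qs).
Qed.

End seminorm_laws.

(** * Topologies generated by seminorms *)

Section seminormed_topology.
Context {R : realType}.

Lemma open_seminorm_ball (V : lmodType R) (P : set (V -> R)) p (v : V) r : P p ->
  open ([set w | p (w - v) < r] : set (seminormed P)).
Proof.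
move=> Pp.
pose B : set (seminormed P) := [set w | p (w - v) < r].
exists [set B] => [_ ->|]; last by rewrite bigcup_set1.
apply: (@finI_from1 _ _ (seminorm_balls P) id B).
by exists p, v, r.
Qed.

(** Around each of its points, the preimage of a ball of a seminorm in Q contains
   a ball of a seminorm in P. *)
Lemma seminormed_continuous (V W : lmodType R) (P : set (V -> R))
    (Q : set (W -> R)) (T : V -> W) : {morph T : v w / v - w} ->
  (forall q, Q q -> forall x y, q (x + y) <= q x + q y) ->
  (forall p, P p -> p 0 <= 0) ->
  (forall q, Q q -> exists p C, [/\ P p, 0 <= C & forall v, q (T v) <= C * p v]) ->
  continuous (T : seminormed P -> seminormed Q).
Proof.
move=> TB QD P0 TQ v B; rewrite nbhsE => -[B' [[D' D'sub <-] [I D'I ITv]] B'B].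
suff TI : nbhs (v : seminormed P) (T @^-1` I : set (seminormed P)).
  by apply: filterS TI => w Iw; apply: B'B; exists I.
have [D Dsub DI] := D'sub _ D'I; rewrite -DI in ITv *.
rewrite preimage_bigcap; apply: filter_bigI => A AD.
have /set_mem[q [w0 [r [Qq AE]]]] := Dsub _ AD.
have : A (T v) by exact: ITv.
rewrite AE /= => qr; have [p [C [Pp C0 CP]]] := TQ q Qq.
have C1 : 0 < C + 1 by rewrite ltr_wpDl.
pose d := (r - q (T v - w0)) / (C + 1).
have d0 : 0 < d by rewrite divr_gt0// subr_gt0.
have : nbhs (v : seminormed P) ([set w | p (w - v) < d] : set (seminormed P)).
  apply: open_nbhs_nbhs; split; first exact: open_seminorm_ball.
  by rewrite /= subrr (le_lt_trans (P0 _ Pp)).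
apply: filterS => w /= pw.
rewrite -(subrKA (T v)) (le_lt_trans (QD q Qq _ _))// -TB -ltrBrDr.
rewrite (le_lt_trans (CP _))// (@le_lt_trans _ _ (C * d))//.
  by rewrite ler_wpM2l// ltW.
by rewrite /d mulrCA gtr_pMr ?subr_gt0// ltr_pdivrMr// mul1r ltrDl.
Qed.

End seminormed_topology.

(** * The isomorphism *)

Section linear_packing.
Context {R : realType} {V W : lmodType R}.

(** The proof of linearity is an argument so that the linear structure can be
   inferred from the function. *)
Definition linear_function (T : V -> W) (_ : linear T) : V -> W := T.

HB.instance Definition _ (T : V -> W) (Tlin : linear T) :=
  GRing.isLinear.Build R V W *:%R (linear_function Tlin) Tlin.

End linear_packing.

Section isomorphism.
Context {R : realType} {E : hausdorffTvsType R} {n : nat}.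
Context (k : option nat) (U : set 'rV[R]_n).
Hypotheses (lcU : locally_convex_subset U) (diU : dense_interior U).
Implicit Types (f : Ck k U E) (F : whitney k U E) (a : mindex n).

Lemma CkP f : is_Ck k f.
Proof. by case: f => f /= /asboolP. Qed.

Definition partial_jet f : jet k U E := fun b => partial (val b) f.

Lemma jcoef_partial_jet f a : leq_ext (msize a) k ->
  jcoef (partial_jet f) a = partial a f.
Proof. by move=> ak; rewrite /jcoef insubT. Qed.

Lemma partial_jet_whitney f : partial_jet f \in @whitney_pred R n k U E.
Proof.
apply/asboolP; apply: family_whitney => //.
have [pc pd] := Ck_derivative_family (CkP f).
have pE a : leq_ext (msize a) k -> jet_ext (partial_jet f) a = ext0 (partial a f).
  by move=> ak; rewrite /jet_ext jcoef_partial_jet.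
split=> [a ak|a v x ak Ux]; first by rewrite pE//; exact: pc.
have ak' : leq_ext (msize a) k by exact: leq_extW ak.
rewrite pE//; under eq_bigr do rewrite pE ?msizeS//.
exact: pd.
Qed.

Definition whitney_of_Ck f : whitney k U E := MkWhitney (partial_jet_whitney f).

Lemma jcoef0_Ck F : jcoef F 0 \in Ck_pred k (U := U).
Proof.
by apply/asboolP; apply: (family_is_Ck (whitney_jet_family F)).
Qed.

Definition Ck_of_whitney F : Ck k U E := MkCk (jcoef0_Ck F).

Lemma whitney_of_CkK : cancel whitney_of_Ck Ck_of_whitney.
Proof.
move=> f; apply: val_inj => /=; rewrite jcoef_partial_jet ?msize0//; last by case: k.
exact: partial0 (CkP f).
Qed.

(** The component a of a Whitney jet is the derivative of order a of its
   component 0. *)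
Lemma Ck_of_whitneyK : cancel Ck_of_whitney whitney_of_Ck.
Proof.
move=> F; apply: val_inj; apply/funext => -[a ak]; apply/funext => x /=.
rewrite /partial_jet /= -ext0E.
rewrite (family_partial diU (whitney_jet_family F))//; last exact: valP.
by rewrite /jet_ext ext0E /jcoef insubT.
Qed.

Lemma Ck_of_whitney_linear : linear Ck_of_whitney.
Proof.
move=> c F G; apply: val_inj; rewrite linearP; apply/funext => x /=.
exact: jcoef_lincomb.
Qed.

(** It is the inverse of a linear bijection. *)
Lemma whitney_of_Ck_linear : linear whitney_of_Ck.
Proof.
move=> c f g; rewrite -[f in LHS]whitney_of_CkK -[g in LHS]whitney_of_CkK.
by rewrite -Ck_of_whitney_linear Ck_of_whitneyK.
Qed.

Lemma Ck_seminormE l q (K : set U) f : leq_ext l k ->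
  Ck_seminorm l q K f = whitney_seminorm' l q K (whitney_of_Ck f).
Proof.
move=> lk; rewrite /Ck_seminorm /whitney_seminorm' !big_seq.
apply: eq_bigr => a; rewrite mem_mindices => al.
by rewrite jcoef_partial_jet//; exact: leq_extW lk.
Qed.

Lemma whitney_of_Ck_continuous : continuous whitney_of_Ck.
Proof.
apply: (@seminormed_continuous _ _ _ (@Ck_seminorms R n k U E)
  (@whitney_seminorms R n k U E)).
- by move=> f g; rewrite addrC -scaleN1r whitney_of_Ck_linear scaleN1r addrC.
- move=> _ [l [q [K [lk qs cK ->]]]] F G; exact: whitney_seminormD.
- move=> _ [l [q [K [lk qs cK ->]]]]; rewrite Ck_seminormE//.
  have -> : whitney_of_Ck 0 = 0.
    have := whitney_of_Ck_linear (-1) 0 0.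
    by rewrite !scaleN1r !oppr0 !add0r addNr.
  exact: whitney_seminorm'0.
- move=> _ [l [q [K [lk qs cK ->]]]].
  have [K' [C [cK' C0 CP]]] := whitney_seminorm_estimate lcU diU lk qs cK.
  exists (Ck_seminorm l q K'), C; split => //; first by exists l, q, K'.
  by move=> f; rewrite Ck_seminormE.
Qed.

Lemma Ck_of_whitney_continuous : continuous Ck_of_whitney.
Proof.
apply: (@seminormed_continuous _ _ _ (@whitney_seminorms R n k U E)
  (@Ck_seminorms R n k U E)).
- by move=> F G; rewrite addrC -scaleN1r Ck_of_whitney_linear scaleN1r addrC.
- move=> _ [l [q [K [lk qs cK ->]]]] f g; rewrite !Ck_seminormE//.
  have := whitney_of_Ck_linear 1 f g; rewrite !scale1r => ->.
  exact: whitney_seminorm'D.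
- move=> _ [l [q [K [lk qs cK ->]]]]; exact: whitney_seminorm0.
- move=> _ [l [q [K [lk qs cK ->]]]].
  exists (whitney_seminorm l q K), 1; split => //; first by exists l, q, K.
  move=> F; rewrite Ck_seminormE// Ck_of_whitneyK mul1r.
  exact: whitney_seminorm'_le_whitney_seminorm.
Qed.

Lemma whitney_topologyE (A : set (whitney k U E)) :
  open A <-> @open (seminormed (@whitney_seminorms' R n k U E)) A.
Proof.
split.
- have : continuous (id : seminormed (@whitney_seminorms' R n k U E) ->
      seminormed (@whitney_seminorms R n k U E)).
    apply: (@seminormed_continuous _ (whitney k U E) (whitney k U E)) => //.
    + move=> _ [l [q [K [lk qs cK ->]]]] F G; exact: whitney_seminormD.
    + move=> _ [l [q [K [lk qs cK ->]]]]; exact: whitney_seminorm'0.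
    + move=> _ [l [q [K [lk qs cK ->]]]].
      have [K' [C [cK' C0 CP]]] := whitney_seminorm_estimate lcU diU lk qs cK.
      by exists (whitney_seminorm' l q K'), C; split => //; exists l, q, K'.
  by move=> /continuousP /(_ A).
- have : continuous (id : seminormed (@whitney_seminorms R n k U E) ->
      seminormed (@whitney_seminorms' R n k U E)).
    apply: (@seminormed_continuous _ (whitney k U E) (whitney k U E)) => //.
    + move=> _ [l [q [K [lk qs cK ->]]]] F G; exact: whitney_seminorm'D.
    + move=> _ [l [q [K [lk qs cK ->]]]]; exact: whitney_seminorm0.
    + move=> _ [l [q [K [lk qs cK ->]]]].
      exists (whitney_seminorm l q K), 1; split => //; first by exists l, q, K.
      move=> F; rewrite mul1r; exact: whitney_seminorm'_le_whitney_seminorm.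
  by move=> /continuousP /(_ A).
Qed.

End isomorphism.

Theorem mainTheorem7 (R : realType) (E : hausdorffTvsType R) (n : nat)
    (n_gt0 : (0 < n)%N) (k : option nat) (U : set 'rV[R]_n)
    (lcU : locally_convex_subset U) (diU : dense_interior U) :
  (exists (rho : {linear Ck k U E -> whitney k U E})
          (Phi : {linear whitney k U E -> Ck k U E}),
     [/\ forall (f : Ck k U E) (a : kmindex n k),
           whitney_val (rho f) a = partial (val a) f,
         forall F : whitney k U E, Ck_val (Phi F) = jcoef F 0,
         cancel rho Phi /\ cancel Phi rho,
         continuous rho &
         continuous Phi]) /\
  (forall A : set (whitney k U E),
     open A <-> @open (seminormed (@whitney_seminorms' R n k U E)) A).
Proof.
split; last exact: whitney_topologyE.
exists (linear_function (@whitney_of_Ck_linear R E n k U lcU diU)).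
exists (linear_function (@Ck_of_whitney_linear R E n k U)).
split=> //.
- split; [exact: whitney_of_CkK|exact: Ck_of_whitneyK].
- exact: whitney_of_Ck_continuous.
- exact: Ck_of_whitney_continuous.
Qed.
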